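(* Let $\Phi$ be an irreducible finite crystallographic root system of rank $n$. The simplicial fan $\Delta(\Phi)$ in $Q_\mathbb{R}$ is the normal fan of a simple $n$-dimensional convex polytope (lying in the dual space $Q_\mathbb{R}^*$).
   Context: $\Phi$ has simple roots $\Pi=\{\alpha_i: i\in I\}$ ($|I|=n$), positive roots $\Phi_{>0}$, root lattice $Q=\mathbb{Z}\Pi$, ambient space $Q_\mathbb{R}$, Cartan matrix $A=(a_{ij})_{i,j\in I}$ with $s_i(\alpha_j)=\alpha_j-a_{ij}\alpha_i$. For $\alpha\in Q_\mathbb{R}$, $[\alpha:\alpha_i]$ denotes the coefficient of $\alpha_i$ in the expansion of $\alpha$ in the basis $\Pi$. The Coxeter graph (vertices $I$, $i,j$ adjacent iff $a_{ij}<0$) is a tree; let $I=I_+\sqcup I_-$ be its bipartition. For a sign $\varepsilon\in\{+,-\}$ define the piecewise-linear map $\tau_\varepsilon:Q_\mathbb{R}\to Q_\mathbb{R}$ by $[\tau_\varepsilon\alpha:\alpha_i]=-[\alpha:\alpha_i]-\sum_{j\neq i}a_{ij}\max([\alpha:\alpha_j],0)$ if $i\in I_\varepsilon$, and $[\tau_\varepsilon\alpha:\alpha_i]=[\alpha:\alpha_i]$ otherwise. Let $\Phi_{\ge -1}=\Phi_{>0}\cup(-\Pi)$; $\tau_\pm$ are involutions preserving $\Phi_{\ge-1}$. The compatibility degree is the unique function $(\alpha\|\beta)$ on $\Phi_{\ge-1}\times\Phi_{\ge-1}$ with nonnegative integer values such that $(-\alpha_i\|\alpha)=\max([\alpha:\alpha_i],0)$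 for all $i\in I$, $\alpha\in\Phi_{\ge-1}$, and $(\tau_\varepsilon\alpha\|\tau_\varepsilon\beta)=(\alpha\|\beta)$ for all $\alpha,\beta$ and both signs. $\alpha,\beta$ are compatible if $(\alpha\|\beta)=0$. A cluster is a maximal set of pairwise compatible elements of $\Phi_{\ge-1}$; every cluster has $n$ elements and is a $\mathbb{Z}$-basis of $Q$, and the cones $\mathbb{R}_{\ge0}C$ over all clusters $C$ (together with their faces) form a complete simplicial fan, denoted $\Delta(\Phi)$. For a full-dimensional simple convex polytope $P$ in a real vector space $V$, its support function is $F(\gamma)=\max_{\varphi\in P}\langle\gamma,\varphi\rangle$ on $V^*$, and its normal fan is the complete simplicial fan in $V^*$ whose maximal cones are the sets $\{\gamma\in V^*: F(\gamma)=\langle\gamma,\varphi\rangle\}$ for the vertices $\varphi$ of $P$ (the domains of linearity of $F$). *)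

(* Defs.v *)
From HB Require Import structures.
From mathcomp Require Import all_boot all_order all_algebra.
From mathcomp Require Import sesquilinear.
From mathcomp Require Import boolp classical_sets functions cardinality reals.

Set Implicit Arguments.
Unset Strict Implicit.
Unset Printing Implicit Defensive.

Import Order.TTheory GRing.Theory Num.Theory.

Local Open Scope classical_set_scope.
Local Open Scope card_scope.
Local Open Scope ring_scope.

Section RootSystems.
Variables (R : realType) (V : vectType R) (form : {dot V for idfun}).
Implicit Types (Phi : seq V) (a b : V).

(* The integer <b, a^vee>, so that s_a(b) = b - <b, a^vee> a. *)
Definition cartan_number a b : R := 2 * form b a / form a a.

Definition reflection a b : V := b - cartan_number a b *: a.

(* Finite, crystallographic and reduced; Phi is used only through membership,
   so repetitions in the sequence are harmless. *)
Record is_root_system Phi : Prop := IsRootSystem {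
  root_span : <<Phi>>%VS = fullv;
  root_neq0 : 0 \notin Phi;
  root_reflection : forall a b, a \in Phi -> b \in Phi ->
    reflection a b \in Phi;
  root_crystallographic : forall a b, a \in Phi -> b \in Phi ->
    cartan_number a b \is a Num.int;
  root_reduced : forall a (k : R), a \in Phi -> k *: a \in Phi ->
    k = 1 \/ k = -1 }.

Definition irreducible_roots Phi : Prop :=
  Phi != [::] /\
  forall A : set V,
    (exists2 a, a \in Phi & A a) -> (exists2 b, b \in Phi & ~ A b) ->
    exists a b, [/\ a \in Phi, b \in Phi, A a, ~ A b & form a b != 0].

End RootSystems.

Section SimpleRoots.
Variables (R : realType) (V : vectType R) (form : {dot V for idfun}).
Variables (Phi : seq V) (n : nat) (Pi : n.-tuple V).
Implicit Types (a b : V) (i j : 'I_n).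

(* The index set I is 'I_n, the i-th simple root is Pi`_i, and [a : alpha_i]
   is coord Pi i a. *)
Record is_simple_system : Prop := IsSimpleSystem {
  simple_basis : basis_of fullv Pi;
  simple_root : {subset Pi <= Phi};
  simple_sign : forall a, a \in Phi ->
    (forall i, coord Pi i a \is a Num.nat) \/
    (forall i, coord Pi i (- a) \is a Num.nat) }.

Definition cartan_matrix : 'M[R]_n :=
  \matrix_(i, j) cartan_number form Pi`_i Pi`_j.

(* A proper 2-colouring of the Coxeter graph: I_+ is the set of the i with
   sgn i = true and I_- the set of the i with sgn i = false. *)
Definition is_bipartition (sgn : 'I_n -> bool) : Prop :=
  forall i j, cartan_matrix i j < 0 -> sgn i != sgn j.

Definition almost_positive_roots : seq V :=
  [seq a <- Phi | [forall i, 0 <= coord Pi i a]] ++ [seq - a | a <- Pi].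

Definition tau (sgn : 'I_n -> bool) (e : bool) (a : V) : V :=
  \sum_(i < n)
    (if sgn i == e
     then - coord Pi i a
          - \sum_(j < n | j != i) cartan_matrix i j * Num.max (coord Pi j a) 0
     else coord Pi i a) *: Pi`_i.

(* The values of c outside almost_positive_roots are never used. *)
Record is_compatibility_degree (sgn : 'I_n -> bool) (c : V -> V -> nat) :
    Prop := IsCompatibilityDegree {
  compat_neg_simple : forall i a, a \in almost_positive_roots ->
    (c (- Pi`_i) a)%:R = Num.max (coord Pi i a) 0;
  compat_tau : forall e a b,
    a \in almost_positive_roots -> b \in almost_positive_roots ->
    c (tau sgn e a) (tau sgn e b) = c a b }.

Definition pairwise_compatible (c : V -> V -> nat) (C : set V) : Prop :=
  C `<=` [set` almost_positive_roots] /\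
  forall a b, C a -> C b -> c a b = 0%N.

Definition cluster (c : V -> V -> nat) (C : set V) : Prop :=
  pairwise_compatible c C /\
  forall D, pairwise_compatible c D -> C `<=` D -> D = C.

End SimpleRoots.

Section Fans.
Variables (R : realType) (V : vectType R).

Definition cone_hull (A : set V) : set V :=
  [set v | exists m (g : 'I_m -> V) (l : 'I_m -> R),
     [/\ forall k, A (g k), forall k, 0 <= l k & v = \sum_k l k *: g k]].

Definition cone_face (K G : set V) : Prop :=
  exists f : 'Hom(V, R^o),
    (forall v, K v -> 0 <= f v :> R) /\ G = K `&` [set v | f v = 0].

(* A fan is represented by the set of all its cones. *)
Definition fan_of (M : set (set V)) : set (set V) :=
  [set G | exists2 K, M K & cone_face K G].

End Fans.

Definition cluster_fan (R : realType) (V : vectType R) (Phi : seq V) (n : nat)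
    (Pi : n.-tuple V) (c : V -> V -> nat) : set (set V) :=
  fan_of [set cone_hull C | C in cluster Phi Pi c].

Section ConvexHull.
Variables (R : realType) (W : vectType R).

Definition conv_hull (A : set W) : set W :=
  [set w | exists m (g : 'I_m -> W) (l : 'I_m -> R),
     [/\ forall k, A (g k), forall k, 0 <= l k, \sum_k l k = 1 &
         w = \sum_k l k *: g k]].

Definition convex_polytope (P : set W) : Prop :=
  exists s : seq W, P = conv_hull [set` s].

(* A is nonempty and its affine hull has dimension d. *)
Definition affine_dim (A : set W) (d : nat) : Prop :=
  exists x (s : seq W), let U := <<[seq y - x | y <- s]>>%VS in
    [/\ A x, forall y, y \in s -> A y, forall y, A y -> y - x \in U &
        \dim U = d].

End ConvexHull.

(* P is a subset of the dual space of V, and V plays the role of the space of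
   linear functionals on this dual. *)
Section DualPolytopes.
Variables (R : realType) (V : vectType R).
Local Notation dual := 'Hom(V, R^o).
Implicit Types (P G : set dual) (phi : dual) (v : V).

(* For a nonempty polytope the supremum is a maximum. *)
Definition support_function P v : R := sup [set (phi v : R) | phi in P].

Definition exposed_face P v : set dual :=
  [set phi | P phi /\ support_function P v = phi v].

Definition vertex P phi : Prop := exists v, exposed_face P v = [set phi].

Definition facet n P G : Prop :=
  (exists v, G = exposed_face P v) /\ affine_dim G n.-1.

Definition simple_polytope n P : Prop :=
  [/\ convex_polytope P, affine_dim P n &
      forall phi, vertex P phi ->
        [set G | facet n P G /\ G phi] #= `I_n].

Definition normal_cone P phi : set V :=
  [set v | support_function P v = phi v].

Definition normal_fan P : set (set V) :=
  fan_of [set normal_cone P phi | phi in vertex P].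

End DualPolytopes.

(* Main.v *)
(* For a simple root alpha_k of the colour read at time t, let f_(t,k)(v) be the
   positive part of the alpha_k-coordinate of v after t alternating applications
   of tau_+ and tau_-. On a set of pairwise compatible roots the coordinates read
   have constant sign, so f_(t,k) is additive there, whereas positive parts are
   only subadditive in general. Hence if a root d outside a compatible set C is a
   linear combination of C, the first t at which some f_(t,k) is not additive on
   this relation gives a strict inequality of convexity type; such a t exists
   since the orbit of d reaches a negative simple root. So, for q small enough,
   F = sum_t q^t sum_k f_(t,k) is strictly convex with respect to the cones of
   the clusters: the linear form phi_C equal to F on the cluster C satisfies
   phi_C(d) < F(d) for every other d. By the same additivity, compatible sets are
   linearly independent.
   Every element of a cluster can be flipped, so a cluster C maximizing phi_C(v)
   has v in its cone: the cones cover the space, and the convex hull of the phi_C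
   is the required polytope. *)

Require Import Defs.
From mathcomp Require Import all_boot all_order all_algebra.
From mathcomp Require Import sesquilinear.
From mathcomp Require Import boolp classical_sets functions cardinality reals.
From mathcomp Require Import ring lra.

Set Implicit Arguments.
Unset Strict Implicit.
Unset Printing Implicit Defensive.

Import Order.TTheory GRing.Theory Num.Theory.

Local Open Scope classical_set_scope.
Local Open Scope ring_scope.

(** * Polytopes from strictly convex functions on simplicial cones *)

Section SupportPolytope.
Variables (R : realType) (V : vectType R) (n : nat) (X : finType).
Variables (C : X -> n.-tuple V) (F : V -> R) (x0 : X).
Implicit Types (x y : X) (i j k : 'I_n) (v d : V) (f : 'Hom(V, R^o)).
Hypothesis n_gt0 : (0 < n)%N.
Hypothesis basisC : forall x, basis_of fullv (C x).
Hypothesis convexF : forall x y d, d \in C y -> d \notin C x ->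
  \sum_i coord (C x) i d * F (C x)`_i < F d.
Hypothesis flipC : forall x i, exists2 y,
  (C x)`_i \notin C y & forall j, j != i -> (C x)`_j \in C y.

Definition cone_linear x : 'Hom(V, R^o) :=
  \sum_(i < n) F (C x)`_i *: linfun (coord (C x) i : V -> R^o).

Local Notation phi := cone_linear.
Local Notation co x i v := (coord (C x) i v).

Let P : set 'Hom(V, R^o) := conv_hull [set` [seq phi x | x : X]].

Let co_sum x v : v = \sum_i co x i v *: (C x)`_i.
Proof. by apply: coord_basis; [exact: basisC | exact: memvf]. Qed.

Let co_C x i j : co x i (C x)`_j = (i == j)%:R.
Proof. by rewrite coord_free 1?eq_sym // (basis_free (basisC x)). Qed.

Let coZ x i (a : R) v : co x i (a *: v) = a * co x i v.
Proof. exact: linearZ. Qed.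

Let co_bigsum x i (I : Type) (r : seq I) (Q : pred I) (g : I -> V) :
  co x i (\sum_(k <- r | Q k) g k) = \sum_(k <- r | Q k) co x i (g k).
Proof. exact: linear_sum. Qed.

Let mem_C x i : (C x)`_i \in C x.
Proof. by rewrite mem_nth // size_tuple. Qed.

Let memCP x d : d \in C x -> exists i, d = (C x)`_i.
Proof.
by case/(nthP 0) => i; rewrite size_tuple => lt <-; exists (Ordinal lt).
Qed.

Lemma lfun_cone x f v : f v = \sum_i co x i v * f (C x)`_i :> R.
Proof.
by rewrite {1}(co_sum x v) linear_sum; apply: eq_bigr => i _; rewrite linearZ.
Qed.

Lemma cone_linearE x v : phi x v = \sum_i co x i v * F (C x)`_i.
Proof.
rewrite sum_lfunE; apply: eq_bigr => i _.
by rewrite scale_lfunE lfunE /= /GRing.scale /= mulrC.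
Qed.

Lemma cone_linear_ray x d : d \in C x -> phi x d = F d.
Proof.
case/memCP => i ->; rewrite cone_linearE (bigD1 i) //= co_C eqxx mul1r.
rewrite big1 ?addr0 // => j ji.
by rewrite co_C (negPf ji) mul0r.
Qed.

Lemma cone_linear_lt x y d : d \in C y -> d \notin C x -> phi x d < F d.
Proof. by move=> dy dx; rewrite cone_linearE; exact: convexF dy dx. Qed.

Lemma cone_linear_le x y d : d \in C y -> phi x d <= F d.
Proof.
move=> dy; have [/cone_linear_ray -> //|dx] := boolP (d \in C x).
exact: ltW (cone_linear_lt dy dx).
Qed.

Lemma polytope_linear x : P (phi x).
Proof.
exists 1%N, (fun=> phi x), (fun=> 1); rewrite !big_ord1 scale1r; split=> //.
by move=> _ /=; apply/mapP; exists x => //; rewrite mem_enum.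
Qed.

Lemma polytope_le f x d : P f -> d \in C x -> f d <= F d :> R.
Proof.
move=> [m [g [l [gP l0 l1 ->]]]] dx; rewrite sum_lfunE.
rewrite -[leRHS]mul1r -l1 mulr_suml; apply: ler_sum => k _.
rewrite scale_lfunE; apply: ler_wpM2l => //.
have /mapP[y _ ->] := gP k; exact: cone_linear_le dx.
Qed.

Lemma cone_hullE x : cone_hull [set` C x] = [set v | forall i, 0 <= co x i v].
Proof.
apply/seteqP; split=> v /=; last first.
  by move=> h; exists n, (fun i => (C x)`_i), (fun i => co x i v);
    split=> [k|//|];
    [exact: mem_C | exact: co_sum].
move=> [m [g [l [gP l0 ->]]]] i; rewrite co_bigsum sumr_ge0 // => k _.
have /memCP[j ->] := gP k.
by rewrite coZ mulr_ge0 // co_C ler0n.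
Qed.

(* v lies in the cone whose linear form is the largest at v: otherwise a flip
   would increase it. *)
Lemma cone_cover v : exists x, forall i, 0 <= co x i v.
Proof.
have [x _ xmax] := @arg_maxP _ _ X x0 xpredT (fun y => phi y v) isT.
exists x => i; rewrite leNgt; apply/negP => neg.
have [y iy jy] := flipC x i.
have : phi y v <= phi x v :> R := xmax y isT.
rewrite leNgt => /negP; apply.
rewrite /= -subr_gt0 !(lfun_cone x _ v) -sumrB (bigD1 i) //= big1 ?addr0.
  rewrite -mulrBr nmulr_rgt0 // subr_lt0 [ltRHS]cone_linear_ray //.
  exact: cone_linear_lt iy.
by move=> j ji; rewrite !cone_linear_ray ?jy // subrr.
Qed.

Lemma cone_support_le x f v : P f -> (forall i, 0 <= co x i v) ->
  f v <= phi x v :> R.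
Proof.
move=> Pf v0; rewrite cone_linearE (lfun_cone x); apply: ler_sum => i _.
by rewrite ler_wpM2l // (polytope_le Pf (mem_C x i)).
Qed.

Lemma support_cone x v : (forall i, 0 <= co x i v) ->
  support_function P v = phi x v.
Proof.
move=> v0; set A := [set (f v : R) | f in P].
have Aphi : A (phi x v) by exists (phi x) => //; exact: polytope_linear.
have ubA : ubound A (phi x v) by move=> _ [f Pf <-]; exact: cone_support_le.
apply/eqP; rewrite eq_le; apply/andP; split; first by apply: ge_sup => //;
  exists (phi x v).
apply: ub_le_sup => //; by exists (phi x v).
Qed.

(** If [v] lies in the cone of [y] and [phi x v] equals the maximum [phi y v], strict convexity
    kills the coefficient of every ray of [y] outside [C x]; so [v] is in the cone of [x]. *)
Lemma normal_cone_linear x : normal_cone P (phi x) = cone_hull [set` C x].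
Proof.
rewrite cone_hullE; apply/seteqP; split=> v /=; last exact: support_cone.
have [y v0] := cone_cover v; rewrite /normal_cone /= (support_cone v0).
move=> e i; rewrite (co_sum y v) co_bigsum sumr_ge0 // => j _.
rewrite coZ; have [jx|jx] := boolP ((C y)`_j \in C x).
  by have [k ->] := memCP jx; rewrite co_C mulr_ge0 ?ler0n.
suff -> : co y j v = 0 by rewrite mul0r.
move: e; rewrite cone_linearE (lfun_cone y) => /eqP; rewrite -subr_eq0 -sumrB.
rewrite psumr_eq0 => [/allP /(_ j (mem_index_enum j)) /=|k _]; last first.
  by rewrite -mulrBr mulr_ge0 // subr_ge0 (cone_linear_le x (mem_C y k)).
rewrite -mulrBr mulf_eq0 subr_eq0 => /orP[/eqP //|].
by rewrite gt_eqF // (cone_linear_lt (mem_C y j) jx).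
Qed.

(** * Faces of the polytope cut out by rays *)

Definition ray_face x (J : pred 'I_n) : set 'Hom(V, R^o) :=
  [set f | P f /\ forall i, J i -> f (C x)`_i = F (C x)`_i].

(** The slack [phi x v - f v] is a sum of nonnegative terms, one per ray, so it vanishes only if
    every ray with positive coefficient is tight. *)
Lemma exposed_face_cone x v : (forall i, 0 <= co x i v) ->
  exposed_face P v = ray_face x (fun i => 0 < co x i v).
Proof.
move=> v0; rewrite /exposed_face (support_cone v0).
apply/seteqP; split=> f /= [Pf h]; split=> //; last first.
  rewrite cone_linearE (lfun_cone x); apply: eq_bigr => i _.
  have := v0 i; rewrite le_eqVlt => /orP[/eqP <-|/h ->//]; by rewrite !mul0r.
move=> i vi; move/eqP: h; rewrite cone_linearE (lfun_cone x) -subr_eq0 -sumrB.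
rewrite psumr_eq0 => [/allP /(_ i (mem_index_enum i)) /=|k _]; last first.
  by rewrite -mulrBr mulr_ge0 // subr_ge0 (polytope_le Pf (mem_C x k)).
by rewrite -mulrBr mulf_eq0 (gt_eqF vi) subr_eq0 => /eqP.
Qed.

Lemma lfun_basis_inj x f (g : 'Hom(V, R^o)) :
  (forall i, f (C x)`_i = g (C x)`_i) -> f = g.
Proof.
move=> e; apply/lfunP => v.
by rewrite (lfun_cone x f v) (lfun_cone x g v); apply: eq_bigr => i _;
  rewrite e.
Qed.

Lemma vertexP f : vertex P f <-> exists x, f = phi x.
Proof.
split=> [[v fv]|[x ->]].
  have [x v0] := cone_cover v; exists x.
  have : exposed_face P v (phi x) by split;
      [exact: polytope_linear | exact: support_cone].
  by rewrite fv.
pose v := \sum_(i < n) (C x)`_i.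
have cv i : co x i v = 1.
  rewrite co_bigsum (bigD1 i) //= co_C eqxx big1 ?addr0 // => j ji.
  by rewrite co_C eq_sym (negPf ji).
exists v; rewrite (@exposed_face_cone x) => [|i]; last by rewrite cv.
apply/seteqP; split=> [g /= [_ h]|_ /= ->].
  by apply: (@lfun_basis_inj x) => i; rewrite h ?cv // cone_linear_ray.
by split=> [|i _]; [exact: polytope_linear | exact: cone_linear_ray].
Qed.

(** * Edges, dimensions of faces, and facets *)

Definition flip x i : X := s2val (cid2 (flipC x i)).

Lemma flip_notin x i : (C x)`_i \notin C (flip x i).
Proof. exact: (s2valP (cid2 (flipC x i))). Qed.

Lemma flip_in x i j : j != i -> (C x)`_j \in C (flip x i).
Proof. exact: (s2valP' (cid2 (flipC x i))). Qed.

(** Vanishes on all rays of [x] but the [i]-th, where it is negative: up to scaling, the edges at a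
    vertex are the basis dual to the rays of its cone. *)
Definition edge x i : 'Hom(V, R^o) := phi (flip x i) - phi x.

Lemma edge_out x i j : j != i -> edge x i (C x)`_j = 0.
Proof.
move=> ji; rewrite /edge add_lfunE opp_lfunE (cone_linear_ray (mem_C x j)).
by rewrite (cone_linear_ray (flip_in x ji)) subrr.
Qed.

Lemma edge_lt0 x i : edge x i (C x)`_i < 0 :> R.
Proof.
rewrite /edge add_lfunE opp_lfunE (cone_linear_ray (mem_C x i)) subr_lt0.
exact: (cone_linear_lt (mem_C x i) (flip_notin x i)).
Qed.

Lemma edge_sum x f :
  f = \sum_(i < n) ((f (C x)`_i : R) / edge x i (C x)`_i) *: edge x i.
Proof.
apply: (@lfun_basis_inj x) => j; rewrite sum_lfunE (bigD1 j) //= big1 ?addr0.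
  by rewrite scale_lfunE /GRing.scale /= divfK // lt_eqF // edge_lt0.
move=> i; rewrite eq_sym => ij; rewrite scale_lfunE (edge_out x ij).
by rewrite /GRing.scale /= mulr0.
Qed.

Lemma span_edge_out x (s : seq 'I_n) i f : i \notin s ->
  f \in <<[seq edge x j | j <- s]>>%VS -> f (C x)`_i = 0.
Proof.
move=> si /(coord_span (X := in_tuple _)) ->.
rewrite sum_lfunE big1 // => k _; rewrite scale_lfunE.
have kl : (k < size s)%N by rewrite -(size_map (edge x) s); exact: ltn_ord.
rewrite (nth_map i) // edge_out; first by rewrite /GRing.scale /= mulr0.
by apply: contraNneq si => ->; exact: mem_nth.
Qed.

Lemma free_edge x (s : seq 'I_n) : uniq s -> free [seq edge x j | j <- s].
Proof.
elim: s => [_|i s IH /= /andP[si us]]; first exact: nil_free.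
rewrite free_cons IH // andbT; apply/negP => /(span_edge_out si) e.
by have := edge_lt0 x i; rewrite e ltxx.
Qed.

Lemma ray_face_linear x (J : pred 'I_n) : ray_face x J (phi x).
Proof. by split=> [|i _]; [exact: polytope_linear | exact: cone_linear_ray].
Qed.

Lemma ray_face_flip x (J : pred 'I_n) i : ~~ J i ->
  ray_face x J (phi (flip x i)).
Proof.
move=> Ji; split=> [|j Jj]; first exact: polytope_linear.
by apply: cone_linear_ray; apply: flip_in; apply: contraNneq Ji => <-.
Qed.

(** Differences of points of the face vanish on the rays in [J], hence lie in the span of the edges
    outside [J]; conversely, the flips across those rays stay in the face. *)
Lemma ray_face_dim x (J : pred 'I_n) (d : nat) :
  affine_dim (ray_face x J) d <-> d = #|[predC J]|.
Proof.
set s := enum [predC J].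
have dims : \dim <<[seq edge x j | j <- s]>> = #|[predC J]|.
  have /eqP -> : free [seq edge x j | j <- s] by apply: free_edge;
      exact: enum_uniq.
  by rewrite size_map cardE.
have spanJ f : (forall i, J i -> f (C x)`_i = 0) ->
    f \in <<[seq edge x j | j <- s]>>%VS.
  move=> fJ; rewrite (edge_sum x f) memv_suml // => i _.
  have [/fJ ->|Ji] := boolP (J i); first by rewrite mul0r scale0r mem0v.
  by apply/memvZ/memv_span/map_f; rewrite mem_enum.
have diffJ f (g : 'Hom(V, R^o)) : ray_face x J f -> ray_face x J g ->
    g - f \in <<[seq edge x j | j <- s]>>%VS.
  move=> [_ fJ] [_ gJ]; apply: spanJ => i Ji.
  by rewrite add_lfunE opp_lfunE fJ ?gJ // subrr.
split=> [[f [r [fG rG rU <-]]]|->].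
  rewrite -dims; congr (\dim _); apply/eqP; rewrite eqEsubv; apply/andP; split.
    apply/span_subvP => _ /mapP[g gr ->]; apply: diffJ => //; exact: rG.
  apply/span_subvP => _ /mapP[i Ji ->]; rewrite mem_enum in Ji.
  have -> : edge x i = (phi (flip x i) - f) - (phi x - f).
    by rewrite opprB addrA subrK.
  by rewrite memvB // rU //; [exact: ray_face_flip | exact: ray_face_linear].
exists (phi x), [seq phi (flip x i) | i <- s]; rewrite -map_comp /=; split.
- exact: ray_face_linear.
- by move=> _ /mapP[i Ji ->]; rewrite mem_enum in Ji; exact: ray_face_flip.
- by move=> g gG; apply: diffJ => //; exact: ray_face_linear.
- exact: dims.
Qed.

Lemma exposed_face_ray x i : exposed_face P (C x)`_i = ray_face x (pred1 i).
Proof.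
rewrite (@exposed_face_cone x) => [|j]; last by rewrite co_C ler0n.
apply/seteqP; split=> f [Pf h]; split=> // j.
  by move=> /eqP ->; apply: h; rewrite co_C eqxx ltr01.
by rewrite co_C; have [->|_] := eqVneq j i; rewrite ?ltxx // => _;
  apply: h => /=.
Qed.

(** A vector exposing a face through [phi x] lies in the cone of [x], and codimension one forces it
    onto a single ray. *)
Lemma facet_linearP x G : facet n P G /\ G (phi x) <->
  exists i, G = exposed_face P (C x)`_i.
Proof.
split=> [[[[v ->]]]|[i ->]].
  move=> dim [_ pv]; have v0 : forall i, 0 <= co x i v.
    by have : normal_cone P (phi x) v := pv;
      rewrite normal_cone_linear cone_hullE.
  move: dim; rewrite (exposed_face_cone v0).
  set J : pred _ := (fun i => _) => /ray_face_dim dim.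
  have : #|J| = 1%N.
    have e := cardC J; rewrite card_ord -dim in e.
    by apply/eqP; rewrite -(eqn_add2r n.-1) e add1n prednK.
  case/mem_card1 => i Ji'; have Ji j : J j = (j == i) := Ji' j; exists i;
    rewrite exposed_face_ray.
  apply/seteqP; split=> f [Pf h]; split=> // j Jj; apply: h.
    by rewrite Ji.
  by rewrite /= -Ji.
split; last by rewrite exposed_face_ray; exact: ray_face_linear.
split; first by exists (C x)`_i.
rewrite exposed_face_ray; apply/ray_face_dim.
by rewrite cardC1 card_ord.
Qed.

Lemma facets_card x : ([set G | facet n P G /\ G (phi x)] #= `I_n)%card.
Proof.
have -> : [set G | facet n P G /\ G (phi x)] =
    (fun k : nat => exposed_face P (nth 0 (C x) k)) @` `I_n.
  apply/seteqP; split=> G /=.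
    by move/facet_linearP => [i ->]; exists i => //=.
  by move=> [k kn <-]; apply/facet_linearP; exists (Ordinal kn).
apply: inj_card_eq => k l; rewrite !inE => kn ln e.
apply/eqP; apply: contraT => kl.
pose i := Ordinal kn; pose j := Ordinal ln.
have ij : j != i by rewrite eq_sym;
    apply: contra kl => /eqP /(congr1 val) /= ->.
(* The flip across ray [i] lies on facet [j] but not on facet [i], so distinct rays expose distinct
   facets. *)
have : exposed_face P (C x)`_j (phi (flip x i)).
  rewrite exposed_face_ray; apply: ray_face_flip; by rewrite /= eq_sym.
have -> : exposed_face P (C x)`_j = exposed_face P (C x)`_i by rewrite /= -e.
rewrite exposed_face_ray => -[_ /(_ i (eqxx _)) h].
by have := cone_linear_lt (mem_C x i) (flip_notin x i); rewrite h ltxx.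
Qed.

Lemma polytope_simple : simple_polytope n P.
Proof.
split.
- by exists [seq phi x | x : X].
- have -> : P = ray_face x0 pred0.
    by apply/seteqP; split=> [f Pf|f []//]; split.
  apply/ray_face_dim; rewrite (eq_card (B := 'I_n)) ?card_ord // => i.
- by move=> f /vertexP[x ->]; exact: facets_card.
Qed.

Lemma normal_fan_polytope :
  normal_fan P = fan_of [set cone_hull [set` C x] | x in [set: X]].
Proof.
rewrite /normal_fan; congr fan_of; apply/seteqP; split=> K /=.
  by move=> [f /vertexP[x ->] <-]; exists x => //; rewrite normal_cone_linear.
move=> [x _ <-]; exists (phi x); last exact: normal_cone_linear.
by apply/vertexP; exists x.
Qed.

Lemma polytope_exists : exists Q : set 'Hom(V, R^o), simple_polytope n Q /\
  fan_of [set cone_hull [set` C x] | x in [set: X]] = normal_fan Q.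
Proof. by exists P; split;
  [exact: polytope_simple | rewrite normal_fan_polytope]. Qed.

End SupportPolytope.

(** * Weights for which the first nonzero term dominates *)

Section LexicographicWeights.
Variables (R : realType) (T : nat).

Lemma lex_weight (D : nat -> R) t0 : (t0 <= T)%N ->
  (forall t, (t < t0)%N -> D t = 0) -> 0 < D t0 ->
  exists2 q0 : R, 0 < q0 & forall q, 0 < q -> q <= q0 ->
    0 < \sum_(t < T.+1) q ^+ t * D t.
Proof.
move=> tT D0 Dt; pose M := \sum_(t < T.+1) `|D t|.
have M0 : 0 <= M by apply: sumr_ge0.
(* [q <= 1] bounds the later powers by [q ^+ t0.+1], and the second bound gives [q * M < D t0]; the
   [+ 1] also covers [M = 0]. *)
exists (Num.min 1 (D t0 / (M + 1))).
  by rewrite lt_min ltr01 divr_gt0 // ltr_wpDl.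
move=> q q0; rewrite le_min ler_pdivlMr ?ltr_wpDl // => /andP[q1 qM].
pose o : 'I_T.+1 := Ordinal (tT : (t0 < T.+1)%N).
have bound : - (q ^+ t0.+1 * M) <= \sum_(i < T.+1 | i != o) q ^+ i * D i.
  rewrite mulr_sumr -sumrN [leLHS](bigD1 o) //=.
  rewrite -[leRHS]add0r lerD ?oppr_le0 ?mulr_ge0 ?exprn_ge0 ?(ltW q0) //.
  apply: ler_sum => i io.
  have [lt|] := ltnP i t0.
    by rewrite D0 // mulr0 oppr_le0 mulr_ge0 ?exprn_ge0 ?(ltW q0).
  rewrite leq_eqVlt => /orP[/eqP e|lt].
    by move: io; rewrite -val_eqE /= -e eqxx.
  have le : q ^+ i <= q ^+ t0.+1 by rewrite ler_wiXn2l // ltW.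
  have h1 : - (q ^+ i * `|D i|) <= q ^+ i * D i.
    by rewrite -mulrN ler_wpM2l ?exprn_ge0 ?(ltW q0) // lerNnormlW.
  by apply: le_trans h1; rewrite lerN2 ler_wpM2r.
rewrite (bigD1 o) //=; have p0 : 0 < q ^+ t0 by rewrite exprn_gt0.
have h : q ^+ t0 * (q * M) < q ^+ t0 * D t0.
  by rewrite ltr_pM2l // (lt_le_trans _ qM) // ltr_pM2l // ltrDl.
move: bound; rewrite exprSr -mulrA => bound; lra.
Qed.

Lemma lex_weights (Y : finType) (D : Y -> nat -> R) :
  (forall y, exists t0, [/\ (t0 <= T)%N, forall t, (t < t0)%N -> D y t = 0
    & 0 < D y t0]) ->
  exists q : R, forall y, 0 < \sum_(t < T.+1) q ^+ t * D y t.
Proof.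
move=> h; have /choice[q0 q0P] : forall y, exists q0 : R, 0 < q0 /\
    forall q, 0 < q -> q <= q0 -> 0 < \sum_(t < T.+1) q ^+ t * D y t.
  by move=> y; have [t0 [tT D0 Dt]] := h y;
    have [q ? ?] := lex_weight tT D0 Dt; exists q.
pose q := \big[Num.min/1]_(y : Y) q0 y.
exists q => y; apply: (q0P y).2; last exact: bigmin_le.
by apply: lt_bigmin => // z _; exact: (q0P z).1.
Qed.

End LexicographicWeights.

(** * Almost positive roots and their tau-orbits *)

Section RootCombinatorics.
Variables (R : realType) (V : vectType R) (form : {dot V for idfun}).
Variables (Phi : seq V) (n : nat) (Pi : n.-tuple V) (sgn : 'I_n -> bool).
Implicit Types (i j k : 'I_n) (v w a : V) (e : bool).
Hypothesis rootP : is_root_system form Phi.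
Hypothesis simpleP : is_simple_system Phi Pi.
Hypothesis bipP : is_bipartition form Pi sgn.

Local Notation co i v := (coord Pi i v).
Local Notation A := (cartan_matrix form Pi).
Local Notation G := (almost_positive_roots Phi Pi).
Local Notation tau := (tau form Pi sgn).

Let freePi : free Pi.
Proof. by apply: basis_free; exact: (simple_basis simpleP). Qed.

Let co_Pi i j : co i Pi`_j = (i == j)%:R.
Proof. by rewrite coord_free // eq_sym. Qed.

Let co_sum v : v = \sum_i co i v *: Pi`_i.
Proof. by apply: coord_basis; [exact: (simple_basis simpleP)|exact: memvf]. Qed.

Let coB i v w : co i (v - w) = co i v - co i w.
Proof. exact: raddfB. Qed.

Let coN i v : co i (- v) = - co i v.
Proof. exact: raddfN. Qed.

Let coZ i (x : R) v : co i (x *: v) = x * co i v.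
Proof. exact: linearZ. Qed.

Let co_bigsum i (I : Type) (r : seq I) (P : pred I) (F : I -> V) :
  co i (\sum_(x <- r | P x) F x) = \sum_(x <- r | P x) co i (F x).
Proof. exact: linear_sum. Qed.

Let co_inj v w : (forall i, co i v = co i w) -> v = w.
Proof.
by move=> e; rewrite (co_sum v) (co_sum w); apply: eq_bigr => i _; rewrite e.
Qed.

Let mem_Pi i : Pi`_i \in Phi.
Proof. by apply: (simple_root simpleP); apply: mem_nth; rewrite size_tuple. Qed.

Let form_sym v w : form v w = form w v.
Proof. by rewrite hermC /= expr0 mul1r. Qed.

(** * Cartan matrix and pairings with simple coroots *)

Lemma root_nz a : a \in Phi -> a != 0.
Proof. by apply: contraTneq => ->; exact: (root_neq0 rootP). Qed.

Let dnorm i : R := form Pi`_i Pi`_i.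

Lemma dnorm_simple_gt0 i : 0 < dnorm i.
Proof. by apply: neq0_dnorm_gt0; exact: root_nz. Qed.

Lemma cartanE i j : dnorm i * A i j = 2 * form Pi`_i Pi`_j.
Proof.
rewrite mxE /cartan_number form_sym mulrCA divff ?mulr1 //.
by rewrite gt_eqF // dnorm_simple_gt0.
Qed.

Lemma cartan_sym i j : dnorm i * A i j = dnorm j * A j i.
Proof. by rewrite !cartanE form_sym. Qed.

Lemma cartan_diag i : A i i = 2.
Proof.
apply: (mulfI (lt0r_neq0 (dnorm_simple_gt0 i))).
by rewrite cartanE mulrC.
Qed.

Definition pairing i v : R := \sum_j A i j * co j v.

Lemma pairingE i v : cartan_number form Pi`_i v = pairing i v.
Proof.
rewrite /cartan_number {1}(co_sum v) linear_sumlz mulr_sumr mulr_suml.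
apply: eq_bigr => j _; rewrite linearZl_LR /= mxE /cartan_number.
ring.
Qed.

Lemma pairing_diag i v : pairing i v =
  2 * co i v + \sum_(j | j != i) A i j * co j v.
Proof. by rewrite /pairing (bigD1 i) //= cartan_diag. Qed.

Lemma root_sign a : a \in Phi ->
  (forall i, 0 <= co i a) \/ (forall i, co i a <= 0).
Proof.
case/(simple_sign simpleP) => h; [left|right] => i.
  by apply: natr_ge0; exact: h.
by rewrite -oppr_ge0 -coN; apply: natr_ge0; exact: h.
Qed.

Lemma reflection_simple k v :
  reflection form Pi`_k v = v - pairing k v *: Pi`_k.
Proof. by rewrite /reflection pairingE. Qed.

Lemma pairing_Pi i j : pairing i Pi`_j = A i j.
Proof.
rewrite /pairing (bigD1 j) //= co_Pi eqxx mulr1 big1 ?addr0 // => k kj.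
by rewrite co_Pi (negPf kj) mulr0.
Qed.

(** The root [s_i(alpha_j)] has [alpha_j]-coordinate 1, so it is positive; its [alpha_i]-coordinate
    is [- A i j]. *)
Lemma cartan_le0 i j : i != j -> A i j <= 0.
Proof.
move=> ij.
have /root_sign : reflection form Pi`_i Pi`_j \in Phi.
  exact: (root_reflection rootP).
have ci : co i (reflection form Pi`_i Pi`_j) = - A i j.
  by rewrite reflection_simple coB coZ !co_Pi pairing_Pi eqxx (negPf ij) mulr1 add0r.
have cj : co j (reflection form Pi`_i Pi`_j) = 1.
  by rewrite reflection_simple coB coZ !co_Pi eqxx eq_sym (negPf ij) mulr0 subr0.
case=> h; first by have := h i; rewrite ci oppr_ge0.
by have := h j; rewrite cj ler10.
Qed.

Lemma cartan_same i j : i != j -> sgn i = sgn j -> A i j = 0.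
Proof.
move=> ij sij; apply/eqP; rewrite eq_le cartan_le0 //= leNgt.
by apply/negP => /bipP; rewrite sij eqxx.
Qed.

Lemma pairing_nondeg v : (forall i, pairing i v = 0) -> v = 0.
Proof.
move=> h; apply/eqP/negP => /negP v0.
have : 0 < form v v by apply: neq0_dnorm_gt0.
rewrite {2}(co_sum v) linear_sumr big1 ?ltxx // => i _.
rewrite linearZr_LR /=.
have := pairingE i v; rewrite h => /eqP; rewrite /cartan_number mulf_eq0.
rewrite invr_eq0 (gt_eqF (dnorm_simple_gt0 i)) orbF mulf_eq0 pnatr_eq0 /=.
by move=> /eqP ->; rewrite mulr0.
Qed.

(** * Positive roots and reflections of one colour *)

Definition posroot a := (a \in Phi) && [forall i : 'I_n, 0 <= co i a].

Lemma posrootP a : reflect (a \in Phi /\ forall i, 0 <= co i a) (posroot a).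
Proof.
by apply: (iffP andP) => -[aP h]; split=> //; [exact/forallP | apply/forallP].
Qed.

Lemma mem_G a : (a \in G) = posroot a || [exists k : 'I_n, a == - Pi`_k].
Proof.
rewrite mem_cat mem_filter andbC; congr (_ || _).
apply/mapP/existsP => [[b /(nthP 0)[i]]|[k /eqP ->]]; last first.
  by exists Pi`_k => //; apply: mem_nth; rewrite size_tuple.
by rewrite size_tuple => ilt <- ->; exists (Ordinal ilt).
Qed.

Lemma G_ind (P : V -> Prop) : (forall a, posroot a -> P a) ->
  (forall k, P (- Pi`_k)) -> forall a, a \in G -> P a.
Proof. by move=> hp hn a; rewrite mem_G => /orP[/hp//|/existsP[k /eqP ->]]. Qed.

Lemma G_neg_simple k : - Pi`_k \in G.
Proof. by rewrite mem_G; apply/orP; right; apply/existsP; exists k. Qed.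

Lemma co_G_ge0 a k : a \in G -> a != - Pi`_k -> 0 <= co k a.
Proof.
move: a; apply: G_ind => [a /posrootP[_ h] _ //|j].
rewrite coN co_Pi; have [->|] := eqVneq k j; first by rewrite eqxx.
by rewrite oppr0.
Qed.

Lemma posroot_simple k : posroot Pi`_k.
Proof. by apply/posrootP; split=> // i; rewrite co_Pi ler0n. Qed.

(* The product of the simple reflections of K, when these commute. *)
Definition reflK (K : pred 'I_n) v : V :=
  v - \sum_(k | K k) pairing k v *: Pi`_k.

Lemma co_reflK K v i : co i (reflK K v) = co i v - (K i)%:R * pairing i v.
Proof.
rewrite /reflK coB raddf_sum /=; congr (_ - _).
under eq_bigr => k _ do rewrite coZ co_Pi.
case: (boolP (K i)) => Ki; rewrite ?mul1r ?mul0r.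
  rewrite (bigD1 i) //= eqxx mulr1 big1 ?addr0 // => k /andP[_ ki].
  by rewrite eq_sym (negPf ki) mulr0.
by rewrite big1 // => k Kk; have [e|] := eqVneq i k; rewrite ?mulr0 //;
  rewrite e Kk in Ki.
Qed.

Definition monochrome (K : pred 'I_n) := forall i j, K i -> K j ->
  sgn i = sgn j.

(** Simple roots of one colour are orthogonal, so the reflections can be applied one at a time
    without changing the remaining pairings. *)
Lemma reflK_root K a : monochrome K -> a \in Phi -> reflK K a \in Phi.
Proof.
move=> mK aP.
suff h (s : seq 'I_n) : uniq s -> all K s ->
    a - \sum_(k <- s) pairing k a *: Pi`_k \in Phi.
  rewrite /reflK -big_filter; apply: h; last exact: filter_all.
  by rewrite filter_uniq // index_enum_uniq.
elim: s => [_ _|k s IHs]; first by rewrite big_nil subr0.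
rewrite /= big_cons => /andP[ks us] /andP[Kk Ks].
have := root_reflection rootP (mem_Pi k) (IHs us Ks).
rewrite reflection_simple.
suff -> : pairing k (a - \sum_(j <- s) pairing j a *: Pi`_j) = pairing k a.
  by rewrite opprD addrA addrAC.
rewrite -!pairingE /cartan_number linearBl /= linear_sumlz big_seq big1 ?subr0 //.
move=> j js; rewrite linearZl_LR /=.
have jk : j != k by apply: contraNneq ks => <-.
have /eqP : dnorm k * A k j = 0.
  by rewrite cartan_same ?mulr0 1?eq_sym //; apply: mK => //; exact: (allP Ks).
rewrite cartanE mulf_eq0 pnatr_eq0 /= form_sym => /eqP ->.
by rewrite mulr0.
Qed.

(** Otherwise the image is a negative root; coordinates outside [K] do not change, so [a] is
    supported on orthogonal simple roots. Reflecting [a] in one [alpha_k] of its support negates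
    that coordinate only, so the others vanish and reducedness gives [a = alpha_k]. *)
Lemma reflK_posroot K a : monochrome K -> posroot a ->
  (forall k, K k -> a != Pi`_k) -> posroot (reflK K a).
Proof.
move=> mK /posrootP[aP a0] aK; apply/posrootP; split; first exact: reflK_root.
have [//|neg] := root_sign (reflK_root mK aP).
have out k : ~~ K k -> co k a = 0.
  move=> Kk; apply/eqP; rewrite eq_le a0 andbT.
  by have := neg k; rewrite co_reflK (negPf Kk) mul0r subr0.
have [k ak] : exists k : 'I_n, co k a != 0.
  apply/existsP; apply: contraNT (root_nz aP) => /existsPn h;
    apply/eqP/co_inj => i.
  by rewrite raddf0; apply/eqP; rewrite -[_ == _]negbK.
have Kk : K k by apply: contraNT ak => /out ->.
suff ae : a = co k a *: Pi`_k.
  have [] := root_reduced rootP (mem_Pi k) (k := co k a); first by rewrite -ae.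
    by move=> e; have := aK k Kk; rewrite {1}ae e scale1r eqxx.
  by move=> e; have := a0 k; rewrite e ler0N1.
have pk : pairing k a = 2 * co k a.
  rewrite pairing_diag big1 ?addr0 // => j jk.
  have [Kj|/out ->] := boolP (K j); last by rewrite mulr0.
  by rewrite cartan_same 1?eq_sym ?mul0r //; exact: mK.
have sk : co k (reflection form Pi`_k a) = - co k a.
  rewrite reflection_simple coB coZ co_Pi eqxx mulr1 pk; ring.
have akgt : 0 < co k a by rewrite lt_def ak a0.
have [] := root_sign (root_reflection rootP (mem_Pi k) aP).
  by move=> /(_ k); rewrite sk oppr_ge0 leNgt akgt.
move=> h; apply: co_inj => j; rewrite coZ co_Pi.
have [->|jk] := eqVneq j k; first by rewrite mulr1.
rewrite mulr0; apply/eqP; rewrite eq_le a0 andbT; have := h j.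
by rewrite reflection_simple coB coZ co_Pi (negPf jk) mulr0 subr0.
Qed.

(** * The maps [tau] on almost positive roots *)

Lemma co_tau e v i : co i (tau e v) =
  if sgn i == e then - co i v - \sum_(j | j != i) A i j * Num.max (co j v) 0
  else co i v.
Proof. by rewrite /Defs.tau coord_sum_free. Qed.

(** [tau e] changes only coordinates of colour [e], and its correction term depends only on the
    other colour. *)
Lemma tauK e : involutive (tau e).
Proof.
move=> v; apply: co_inj => i; rewrite !co_tau; case: eqP => // si.
suff -> : \sum_(j | j != i) A i j * Num.max (co j (tau e v)) 0
   = \sum_(j | j != i) A i j * Num.max (co j v) 0 by ring.
apply: eq_bigr => j ji; rewrite co_tau; case: ifP => // /eqP sj.
by rewrite cartan_same 1?eq_sym ?mul0r // si sj.
Qed.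

Lemma tau_linear e v : (forall j, sgn j != e -> 0 <= co j v) ->
  tau e v = reflK (fun i => sgn i == e) v.
Proof.
move=> h; apply: co_inj => i; rewrite co_tau co_reflK;
  case: ifP => /= [/eqP si|_]; last by rewrite mul0r subr0.
rewrite mul1r pairing_diag opprD addrA.
congr (_ - _); first by ring.
apply: eq_bigr => j ji; have [sj|sj] := eqVneq (sgn j) e.
  by rewrite cartan_same 1?eq_sym ?mul0r // si sj.
by rewrite max_l // h.
Qed.

Lemma tau_neg_simple e k : tau e (- Pi`_k) =
  if sgn k == e then Pi`_k else - Pi`_k.
Proof.
apply: co_inj => i; rewrite co_tau big1 ?subr0; last first.
  by move=> j _; rewrite max_r ?mulr0 // coN co_Pi oppr_le0 ler0n.
rewrite coN opprK co_Pi.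
case: (eqVneq i k) => [->|ik]; first by case: ifP; rewrite ?coN co_Pi eqxx.
by case: ifP; case: ifP; rewrite ?coN co_Pi (negPf ik) ?oppr0.
Qed.

Lemma tau_simple e k : sgn k = e -> tau e Pi`_k = - Pi`_k.
Proof.
by move=> sk; have := tauK e (- Pi`_k); rewrite tau_neg_simple sk eqxx.
Qed.

Lemma tau_posroot e a : posroot a -> (forall k, sgn k = e -> a != Pi`_k) ->
  posroot (tau e a).
Proof.
move=> aP h; rewrite tau_linear; last by move=> j _; case/posrootP: aP.
by apply: reflK_posroot => // [i j /eqP -> /eqP //|k /eqP/h].
Qed.

Lemma tau_G e a : a \in G -> tau e a \in G.
Proof.
move: a; apply: G_ind => [a aP|k].
  have [/existsP[k /andP[/eqP sk /eqP ->]]|/existsPn h] :=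
      boolP [exists k : 'I_n, (sgn k == e) && (a == Pi`_k)].
    by rewrite tau_simple // G_neg_simple.
  rewrite mem_G tau_posroot // => k sk.
  by have := h k; rewrite sk eqxx.
rewrite tau_neg_simple; case: ifP => _; last exact: G_neg_simple.
by rewrite mem_G posroot_simple.
Qed.

(** * Alternating orbits and their visits to negative simple roots *)

Lemma pairing_sum i (I : Type) (r : seq I) (P : pred I) (F : I -> V) :
  pairing i (\sum_(x <- r | P x) F x) = \sum_(x <- r | P x) pairing i (F x).
Proof.
rewrite /pairing exchange_big /=; apply: eq_bigr => j _.
by rewrite linear_sum mulr_sumr.
Qed.

Fixpoint orbit (t : nat) v : V :=
  if t is t'.+1 then tau (~~ odd t') (orbit t' v) else v.

(** The next map, [tau (~~ odd t)], fixes this [-alpha_k] and reads the coordinates of colour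
    [odd t]: a hit is the first of the two consecutive times spent at [-alpha_k]. *)
Definition hits (t : nat) k v := (orbit t v == - Pi`_k) && (sgn k == odd t).

Lemma orbit_G t a : a \in G -> orbit t a \in G.
Proof. by move=> aG; elim: t => //= t; exact: tau_G. Qed.

Lemma orbit_inj t : injective (orbit t).
Proof. by elim: t => [//|t IH] v w /= /(inv_inj (tauK _)) /IH. Qed.

Lemma orbit_onto t b : b \in G -> exists2 a, a \in G & orbit t a = b.
Proof.
elim: t b => [|t IH] b bG; first by exists b.
have [a aG ab] := IH _ (tau_G (~~ odd t) bG).
by exists a => //=; rewrite ab tauK.
Qed.

(** A negative simple root at time [t] that is not a hit has the colour of the next map, which makes
    it positive; a positive root turns negative only by a hit at [t.+1]. *)
Lemma orbit_posroot a t : a \in G -> (forall k, ~~ hits t k a) ->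
  (forall k, ~~ hits t.+1 k a) -> posroot (orbit t.+1 a).
Proof.
rewrite /hits /= => aG h0 h1; move: (orbit_G t aG) h0 h1.
move: (orbit t a); apply: G_ind => [b bP _ h1|k h0 _].
  apply: tau_posroot => // k sk; apply: contraT; rewrite negbK => /eqP be.
  by have := h1 k; rewrite be tau_simple // eqxx sk eqxx.
rewrite tau_neg_simple; have := h0 k; rewrite eqxx /=.
by case: (sgn k); case: (odd t) => //= _; rewrite posroot_simple.
Qed.

(* Otherwise the sum of a periodic stretch of the orbit would be a nonzero
   vector fixed by both factors of the bipartite Coxeter element. *)
Lemma orbit_hits a t0 : a \in G -> exists t k, (t0 <= t)%N /\ hits t k a.
Proof.
move=> aG; apply: contrapT => nh.
have noh t k : (t0 <= t)%N -> ~~ hits t k a.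
  by move=> le; apply/negP => hk; apply: nh; exists t, k.
have pos t : (t0 < t)%N -> posroot (orbit t a).
  case: t => // t lt; apply: orbit_posroot => // k; apply: noh => //.
  exact: leqW.
have step t i : (t0 < t)%N -> co i (orbit t.+1 a) =
    co i (orbit t a) - (sgn i == ~~ odd t)%:R * pairing i (orbit t a).
  move=> /pos /posrootP[_ p] /=; rewrite tau_linear ?co_reflK // => j _;
    exact: p.
have [m0 [ltm om]] : exists m, (t0 < m)%N /\ odd m = false.
  by exists (t0.+1).*2; rewrite odd_double -addnn addSn ltnS leq_addr.
pose b r := orbit (m0 + r.*2) a.
have ltb r : (t0 < m0 + r.*2)%N by exact: ltn_addr.
have bP r : posroot (b r) by exact: pos.
(* Pigeonhole: one more even time than there are entries in [Phi]. *)
have : ~~ uniq [seq b r | r <- iota 0 (size Phi).+1].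
  apply: contraL (leqnn (size Phi).+1) => u; rewrite -ltnNge ltnS.
  rewrite -[X in (X <= _)%N](size_iota 0) -(size_map b);
    apply: uniq_leq_size u _.
  by move=> _ /mapP[r _ ->]; case/posrootP: (bP r).
case/(uniqPn 0) => s [s' []]; rewrite size_map size_iota => lss ls'.
rewrite !(nth_map 0%N) ?size_iota //; last exact: ltn_trans ls'.
rewrite !nth_iota //; last exact: ltn_trans ls'.
rewrite !add0n => bss.
(* Sums over a period of the even and of the odd positions; the reflections of one colour carry each
   to the other. *)
pose psi := \sum_(s <= r < s') b r.
pose psi' := \sum_(s <= r < s') orbit (m0 + r.*2).+1 a.
have odb r : odd (m0 + r.*2) = false by rewrite oddD om odd_double.
have e1 i : co i psi' = co i psi - (sgn i)%:R * pairing i psi.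
  rewrite /psi /psi' !co_bigsum pairing_sum mulr_sumr -sumrB.
  by apply: eq_bigr => r _; rewrite step // odb /= eqb_id.
have psiE : psi = \sum_(s <= r < s') b r.+1.
  apply/eqP; rewrite eq_sym -subr_eq0 -sumrB.
  by rewrite telescope_sumr 1?ltnW // bss subrr.
have e2 i : co i psi = co i psi' - (~~ sgn i)%:R * pairing i psi'.
  rewrite psiE /psi' !co_bigsum pairing_sum mulr_sumr -sumrB.
  apply: eq_bigr => r _; rewrite /b doubleS !addnS step; last exact: leqW.
  by rewrite /= odb /= eqbF_neg.
(* [e1] leaves one colour untouched and [e2] the other; once the sums agree, both reflections fix
   [psi] and all its pairings vanish. *)
have psie : psi' = psi.
  apply: co_inj => i; case si: (sgn i); last by rewrite e1 si mul0r subr0.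
  by rewrite e2 si mul0r subr0.
have psi0 : psi = 0.
  apply: pairing_nondeg => i; have := e1 i; have := e2 i; rewrite psie.
  by case: (sgn i); rewrite /= mul0r mul1r subr0 => h1 h2; lra.
case/posrootP: (bP s) => /root_nz /negP[]; apply/eqP/co_inj => i.
have : co i psi = 0 by rewrite psi0 raddf0.
rewrite raddf0 /psi co_bigsum => /eqP.
rewrite psumr_eq0 => [|r _]; last by case/posrootP: (bP r).
by move=> /allP /(_ s); rewrite mem_index_iota leqnn lss /= => /(_ isT) /eqP.
Qed.

Lemma hit_coG t k a b : a \in G -> b \in G -> a != b -> hits t k a ->
  0 <= co k (orbit t b).
Proof.
move=> aG bG ab /andP[/eqP ha _]; apply: co_G_ge0; first exact: orbit_G.
by rewrite -ha (inj_eq (@orbit_inj t)) eq_sym.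
Qed.

(** * Euler forms and the symmetry of compatibility *)

Definition opp_sum e i v : R := \sum_(k | sgn k != e) A i k * co k v.

(* [euler e] is the Euler form of the Coxeter graph oriented from one colour to
   the other, and [tau e] acts on it as a reflection functor. *)
Definition euler e v w : R :=
  \sum_(i | sgn i == e) dnorm i * co i v * (co i w + opp_sum e i w)
  + \sum_(k | sgn k != e) dnorm k * co k v * co k w.

Lemma eulerE e v w : euler e v w = \sum_i dnorm i * co i v * co i w +
  \sum_(i | sgn i == e) \sum_(k | sgn k != e) dnorm i * A i k * co i v * co k w.
Proof.
rewrite (bigID (fun i => sgn i == e)) /= -addrA [X in _ + X]addrC addrA -big_split.
congr (_ + _); apply: eq_bigr => i _ /=; rewrite mulrDr mulr_sumr;
  congr (_ + _).
by apply: eq_bigr => k _; ring.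
Qed.

Lemma euler_swap e v w : euler (~~ e) v w = euler e w v.
Proof.
rewrite !eulerE; congr (_ + _); first by apply: eq_bigr => i _; rewrite mulrAC.
rewrite exchange_big; apply: eq_big => [k|k _].
  by case: (sgn k); case: (e).
apply: eq_big => [i|i _]; first by case: (sgn i); case: (e).
by rewrite cartan_sym mulrAC.
Qed.

Lemma co_tau_opp e v i : (forall j, sgn j != e -> 0 <= co j v) ->
  co i (tau e v) = if sgn i == e then - co i v - opp_sum e i v else co i v.
Proof.
move=> h; rewrite co_tau; case: eqP => // si; congr (_ - _).
rewrite (bigID (fun j => sgn j == e)) /= big1 ?add0r; last first.
  by move=> j /andP[ji /eqP sj]; rewrite cartan_same 1?eq_sym ?mul0r // si sj.
rewrite /opp_sum; apply: eq_big => [j|j /andP[_ sj]].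
  by have [->|//] := eqVneq j i; rewrite si eqxx.
by rewrite max_l // h.
Qed.

(** For [i] of colour [e], [tau e] exchanges [co i x] and [co i x + opp_sum e i x] up to sign,
    whence the swapped arguments. *)
Lemma euler_tau e v w : (forall j, sgn j != e -> 0 <= co j v) ->
  (forall j, sgn j != e -> 0 <= co j w) ->
  euler e (tau e v) (tau e w) = euler e w v.
Proof.
move=> hv hw; rewrite /euler; congr (_ + _); last first.
  by apply: eq_bigr => k /negPf sk; rewrite !co_tau_opp // sk mulrAC.
apply: eq_bigr => i si; rewrite !co_tau_opp // si.
have -> : opp_sum e i (tau e w) = opp_sum e i w.
  by apply: eq_bigr => k /negPf sk; rewrite co_tau_opp // sk.
ring.
Qed.

Definition opp_simple v := [exists k : 'I_n, v == - Pi`_k].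

(* The negative part of the Euler form plays the role of an Ext group; this
   description of compatibility is symmetric, unlike the definition of c. *)
Definition ncompat v w :=
  (forall e, 0 <= euler e v w) \/ (opp_simple v /\ opp_simple w).

Lemma ncompat_sym v w : ncompat v w -> ncompat w v.
Proof.
case=> [h|[hv hw]]; last by right.
by left=> e; rewrite -euler_swap.
Qed.

Lemma euler_inactive e k w : sgn k != e ->
  euler e (- Pi`_k) w = - (dnorm k * co k w).
Proof.
move=> sk; rewrite /euler big1 ?add0r => [|i /eqP si]; last first.
  have ik : i != k by apply: contraNneq sk => <-; rewrite si.
  by rewrite coN co_Pi (negPf ik) oppr0 mulr0 mul0r.
rewrite (bigD1 k) //= coN co_Pi eqxx /= big1 ?addr0; first by ring.
by move=> i /andP[_ ik]; rewrite coN co_Pi (negPf ik) oppr0 mulr0 mul0r.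
Qed.

(** For a positive root [w], the form in the orientation [~~ sgn k] is a negative multiple of
    [co k w]; in the other it is nonnegative once that coordinate vanishes, off-diagonal Cartan
    entries being nonpositive. *)
Lemma ncompat_neg_simple k w : w \in G -> ncompat (- Pi`_k) w <-> co k w <= 0.
Proof.
have opk : opp_simple (- Pi`_k) by apply/existsP; exists k.
move: w; apply: G_ind => [w /posrootP[wP w0]|j]; last first.
  split=> _; first by rewrite coN co_Pi oppr_le0 ler0n.
  by right; split=> //; apply/existsP; exists j.
have nk : sgn k != ~~ sgn k by case: (sgn k).
split=> [[/(_ (~~ sgn k))|[_ /existsP[j /eqP we]]]|wk].
- by rewrite euler_inactive // oppr_ge0 pmulr_rle0 // dnorm_simple_gt0.
- by have := w0 j; rewrite we coN co_Pi eqxx oppr_ge0 ler10.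
- left=> e; have wk0 : co k w = 0 by apply/eqP; rewrite eq_le wk w0.
  have [ske|] := boolP (sgn k != e);
      first by rewrite euler_inactive // wk0 mulr0 oppr0.
  rewrite negbK => /eqP ske; rewrite -[e]negbK euler_swap -ske /euler.
  rewrite addr_ge0 // sumr_ge0 // => i si.
    rewrite mulr_ge0 ?mulr_ge0 ?(ltW (dnorm_simple_gt0 _)) //.
    have ik : i != k by apply: contraTneq si => ->.
    rewrite coN co_Pi (negPf ik) oppr0 add0r sumr_ge0 // => j _.
    rewrite coN co_Pi; have [->|_] := eqVneq j k; last by rewrite oppr0 mulr0.
    by rewrite mulrN1 oppr_ge0 cartan_le0.
  have [->|ik] := eqVneq i k; first by rewrite wk0 mulr0 mul0r.
  by rewrite coN co_Pi (negPf ik) oppr0 mulr0.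
Qed.

(** Where [tau e] is linear on both arguments, it transposes the Euler forms; otherwise one argument
    is some [-alpha_k] fixed by [tau e], and compatibility with it depends on the coordinate [co k],
    which [tau e] keeps. *)
Lemma ncompat_tau e v w : v \in G -> w \in G -> ncompat v w ->
  ncompat (tau e v) (tau e w).
Proof.
have inact k x : sgn k != e -> x \in G -> ncompat (- Pi`_k) x ->
    ncompat (tau e (- Pi`_k)) (tau e x).
  move=> sk xG; rewrite tau_neg_simple (negPf sk) !ncompat_neg_simple ?tau_G //.
  by rewrite co_tau (negPf sk).
have lin x : x \in G -> (forall j, sgn j != e -> 0 <= co j x) \/
    exists2 k, sgn k != e & x = - Pi`_k.
  move: x; apply: G_ind => [x /posrootP[_ h]|k]; first by left.
  have [sk|sk] := eqVneq (sgn k) e; last by right; exists k.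
  left=> j sj; rewrite coN co_Pi; have [jk|] := eqVneq j k;
    last by rewrite oppr0.
  by rewrite jk sk eqxx in sj.
move=> vG wG vw; case: (lin v vG) => [lv|[k sk ve]];
  last by rewrite ve in vw *; exact: inact.
case: (lin w wG) => [lw|[k sk we]]; last first.
  by rewrite we in vw *; apply: ncompat_sym; apply: inact => //;
    exact: ncompat_sym.
have {}vw f : 0 <= euler f v w.
  case: vw => [//|[/existsP[i /eqP ve] /existsP[j /eqP we]]].
  have si : sgn i = e.
    by apply/eqP; apply: contraT => /lv;
      rewrite ve coN co_Pi eqxx oppr_ge0 ler10.
  have sj : sgn j = e.
    by apply/eqP; apply: contraT => /lw;
      rewrite we coN co_Pi eqxx oppr_ge0 ler10.
  have [sif|] := boolP (sgn i != f);
      first rewrite ve euler_inactive // we coN co_Pi.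
    by rewrite mulrN opprK mulr_ge0 ?ler0n // ltW // dnorm_simple_gt0.
  rewrite negbK => /eqP sif; rewrite -[f]negbK euler_swap we euler_inactive.
    by rewrite ve coN co_Pi mulrN opprK mulr_ge0 ?ler0n // ltW // dnorm_simple_gt0.
  by rewrite sj -si sif; case: (f).
have swap f : 0 <= euler f w v by rewrite -euler_swap.
left=> f; have [->|fe] := eqVneq f e; first by rewrite euler_tau.
have -> : f = ~~ e by move: fe; case: (f); case: (e).
by rewrite euler_swap euler_tau.
Qed.

(** * Coordinates of compatible sets along orbits *)

Variable c : V -> V -> nat.
Hypothesis compP : is_compatibility_degree form Phi Pi sgn c.

Lemma compat_orbit t v w : v \in G -> w \in G ->
  c (orbit t v) (orbit t w) = c v w.
Proof.
move=> vG wG; elim: t => //= t <-.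
by rewrite (compat_tau compP) // orbit_G.
Qed.

Lemma compat_neg_simple0 k w : w \in G ->
  (c (- Pi`_k) w == 0%N) = (co k w <= 0).
Proof.
by move=> wG; rewrite -(pnatr_eq0 R) (compat_neg_simple compP) // eq_maxr.
Qed.

(** Both sides are invariant along orbits, and when [v] reaches [-alpha_k] both say that a
    coordinate of [w] is nonpositive. *)
Lemma compat_ncompat v w : v \in G -> w \in G -> c v w = 0%N <-> ncompat v w.
Proof.
move=> vG wG; have [t [k [_ /andP[/eqP hk _]]]] := orbit_hits 0 vG.
have orb s : ncompat v w <-> ncompat (orbit s v) (orbit s w).
  elim: s => //= s ->; split; first by apply: ncompat_tau; exact: orbit_G.
  have oG u : u \in G -> tau (~~ odd s) (orbit s u) \in G.
    by move=> uG; exact/tau_G/orbit_G.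
  by move/(ncompat_tau (~~ odd s) (oG _ vG) (oG _ wG)); rewrite !tauK.
rewrite -(compat_orbit t vG wG) (orb t) hk ncompat_neg_simple ?orbit_G //.
rewrite -compat_neg_simple0 ?orbit_G //; by split=> /eqP.
Qed.

Lemma compat_sym v w : v \in G -> w \in G -> c v w = 0%N -> c w v = 0%N.
Proof. by move=> vG wG; rewrite !compat_ncompat //; exact: ncompat_sym. Qed.

Lemma compat_refl v : v \in G -> c v v = 0%N.
Proof.
move=> vG; have [t [k [_ /andP[/eqP hk _]]]] := orbit_hits 0 vG.
apply/eqP; rewrite -(compat_orbit t vG vG) hk compat_neg_simple0 ?G_neg_simple //.
by rewrite coN co_Pi eqxx oppr_le0.
Qed.

Definition pcompat (s : seq V) :=
  all [in G] s && all2rel (fun v w => c v w == 0%N) s.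

Lemma pcompatP s :
  reflect ({subset s <= G} /\ {in s &, forall v w, c v w = 0%N}) (pcompat s).
Proof.
apply: (iffP andP) => [[/allP sG /allrelP h]|[sG h]]; split=> //.
- by move=> v w vs ws; apply/eqP/h.
- exact/allP.
- by apply/allrelP => v w vs ws; apply/eqP/h.
Qed.

Lemma pcompat_co s t k a b : pcompat s -> a \in s -> b \in s -> hits t k a ->
  co k (orbit t b) <= 0.
Proof.
move=> /pcompatP[sG h] aS bS /andP[/eqP ha _].
by rewrite -compat_neg_simple0 ?orbit_G ?sG // -ha compat_orbit ?sG // h.
Qed.

Lemma pcompat_co0 s t k a b : pcompat s -> a \in s -> b \in s -> a != b ->
  hits t k a -> co k (orbit t b) = 0.
Proof.
move=> sP aS bS ab ha; have [sG _] := pcompatP _ sP.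
apply/eqP; rewrite eq_le (pcompat_co sP aS bS ha).
by rewrite (hit_coG (sG _ aS) (sG _ bS) ab ha).
Qed.

(** A negative [k]-th coordinate occurs only at [-alpha_k], that is, at a hit, and compatibility
    then makes this coordinate nonpositive on all of [s]. *)
Lemma pcompat_active s t k : pcompat s -> sgn k = odd t ->
  (exists2 a, a \in s & hits t k a) /\
    {in s, forall b, co k (orbit t b) <= 0} \/
  {in s, forall b, 0 <= co k (orbit t b)}.
Proof.
move=> sP sk; have [/hasP[a aS ha]|/hasPn nh] := boolP (has (hits t k) s).
  by left; split=> [|b bS]; [exists a|exact: pcompat_co aS bS ha].
right=> b bS; apply: co_G_ge0.
  by apply: orbit_G; have [sG _] := pcompatP _ sP; exact: sG.
by have := nh _ bS; rewrite /hits sk eqxx andbT.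
Qed.

(** * Linear relations transported along orbits *)

Lemma tau_combination e (I J : finType) (m : I -> R) (y : I -> V) (l : J -> R)
    (z : J -> V) :
  \sum_i m i *: y i = \sum_j l j *: z j ->
  (forall k, sgn k != e -> \sum_i m i * Num.max (co k (y i)) 0 =
                          \sum_j l j * Num.max (co k (z j)) 0) ->
  \sum_i m i *: tau e (y i) = \sum_j l j *: tau e (z j).
Proof.
have co_comb i (K : finType) (w : K -> R) (x : K -> V) :
    co i (\sum_j w j *: x j) = \sum_j w j * co i (x j).
  by rewrite co_bigsum; apply: eq_bigr => j _; rewrite coZ.
move=> eyz emax; apply: co_inj => i.
have eco : \sum_i0 m i0 * co i (y i0) = \sum_j l j * co i (z j).
  by rewrite -!co_comb eyz.
rewrite !co_comb.
under eq_bigr do rewrite co_tau; under [RHS]eq_bigr do rewrite co_tau.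
case: eqP => // si.
have red (K : finType) (w : K -> R) (x : K -> V) :
  \sum_(j : K) w j * (- co i (x j) - \sum_(k | k != i) A i k * Num.max (co k (x j)) 0)
  = - (\sum_j w j * co i (x j))
    - \sum_(k | k != i) A i k * \sum_j w j * Num.max (co k (x j)) 0.
  rewrite -sumrN; under [X in _ = _ - X]eq_bigr do rewrite mulr_sumr.
  rewrite exchange_big -sumrB; apply: eq_bigr => j _ /=.
  rewrite mulrBr mulrN mulr_sumr; congr (_ - _).
  by apply: eq_bigr => k _; rewrite mulrCA.
rewrite !red eco; congr (_ - _); apply: eq_bigr => k ki.
have [sk|sk] := eqVneq (sgn k) e; last by rewrite emax.
by rewrite cartan_same 1?eq_sym ?mul0r // si sk.
Qed.

(** Additivity carries a relation through all times; at a hit of one member the others have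
    coordinate zero, which isolates its coefficient. *)
Lemma free_pcompat s : uniq s -> pcompat s -> free s.
Proof.
move=> us sP; rewrite -[s]/(tval (in_tuple s)); apply/freeP => m m0 i.
move: m i m0; rewrite /= => m i m0.
have mem (j : 'I_(size s)) : s`_j \in s by rewrite mem_nth.
have [sG _] := pcompatP _ sP.
have orb0 t : \sum_(j : 'I_(size s)) m j *: orbit t s`_j = 0.
  elim: t => [//|t IH]; have := @tau_combination (~~ odd t) _ 'I_0 m
    (fun j : 'I_(size s) => orbit t s`_j) (fun=> 0) (fun=> 0).
  rewrite !big_ord0; apply=> // k sk; rewrite big_ord0.
  have {}sk : sgn k = odd t by move: sk; case: (sgn k); case: (odd t).
  have [[_ h]|h] := pcompat_active sP sk.
    by rewrite big1 // => j _; rewrite max_r ?mulr0 ?h.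
  under eq_bigr do rewrite max_l ?h // -coZ.
  by rewrite -co_bigsum IH raddf0.
have [t [k [_ hk]]] := orbit_hits 0 (sG _ (mem i)).
have := congr1 (fun v => co k v) (orb0 t);
    rewrite raddf0 co_bigsum (bigD1 i) //=.
rewrite big1 => [|j ji].
  case/andP: hk => /eqP -> _; rewrite coZ coN co_Pi eqxx mulrN1 addr0.
  by move/eqP; rewrite oppr_eq0 => /eqP.
rewrite coZ (pcompat_co0 sP (mem i) (mem j) _ hk) ?mulr0 //.
by rewrite nth_uniq // eq_sym.
Qed.

(* At time t the coordinates of colour [odd t] are read, the others updated. *)
Definition orbit_height (t : nat) v : R :=
  \sum_(k | sgn k == odd t) Num.max (co k (orbit t v)) 0.

(* Iterating tau, the first step at which the active coordinates of d stop
   being the linear combination of those of the compatible family is a strict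
   inequality of convexity type. *)
Lemma orbit_height_lex (I : finType) (s : seq V) (x : I -> V) (m : I ->
  R) d T k :
  pcompat s -> (forall u, x u \in s) -> d \notin s -> d = \sum_i m i *: x i ->
  d \in G -> hits T k d ->
  exists t0, [/\ (t0 <= T)%N,
    forall t, (t < t0)%N -> orbit_height t d =
      \sum_i m i * orbit_height t (x i) &
    \sum_i m i * orbit_height t0 (x i) < orbit_height t0 d].
Proof.
move=> sP xs ds dE dG hT; have [sG _] := pcompatP _ sP.
pose P t j := \sum_i m i * Num.max (co j (orbit t (x i))) 0.
have hP t : \sum_i m i * orbit_height t (x i) = \sum_(j | sgn j == odd t) P t j.
  rewrite exchange_big; apply: eq_bigr => i _ /=.
  by rewrite /orbit_height mulr_sumr.
have Plin t j : orbit t d = \sum_i m i *: orbit t (x i) ->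
    {in s, forall b, 0 <= co j (orbit t b)} -> P t j = co j (orbit t d).
  move=> -> h; rewrite co_bigsum; apply: eq_bigr => i _.
  by rewrite coZ max_l // h.
(* By constant sign, the combination of positive parts is either the coordinate of [d] itself or
   zero. *)
have Ple t j : orbit t d = \sum_i m i *: orbit t (x i) -> sgn j = odd t ->
    P t j <= Num.max (co j (orbit t d)) 0.
  move=> e sj; have [[_ h]|h] := pcompat_active sP sj; last first.
    by rewrite (Plin _ _ e h) le_max lexx.
  rewrite /P big1 => [|i _]; last by rewrite max_r ?mulr0 ?h.
  by rewrite le_max lexx orbT.
have eq_orb t : (forall t', (t' < t)%N ->
    orbit_height t' d = \sum_i m i * orbit_height t' (x i)) ->
    orbit t d = \sum_i m i *: orbit t (x i).
  elim: t => [//|t IH] h.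
  have {}IH : orbit t d = \sum_i m i *: orbit t (x i).
    by apply: IH => t' lt; apply: h; exact: leqW.
  (* Equal heights and termwise inequalities force equality in every coordinate read, so the
     relation passes to [t.+1]. *)
  have := h t (ltnSn t); rewrite hP => /esym/eqP.
  rewrite -subr_eq0 -sumrB -oppr_eq0 -sumrN.
  rewrite psumr_eq0 => [/allP ht|j /eqP sj];
    last by rewrite oppr_ge0 subr_le0 Ple.
  have := @tau_combination (~~ odd t) 'I_1 _ (fun=> 1) (fun=> orbit t d) m
    (fun u => orbit t (x u)).
  rewrite !big_ord1 !scale1r; apply=> // j sj; rewrite big_ord1 mul1r.
  have := ht j (mem_index_enum j); move: sj; case: (sgn j);
      case: (odd t) => //= _.
    by rewrite oppr_eq0 subr_eq0 => /eqP.
  by rewrite oppr_eq0 subr_eq0 => /eqP.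
have le t : orbit t d = \sum_i m i *: orbit t (x i) ->
    \sum_i m i * orbit_height t (x i) <= orbit_height t d.
  by move=> e; rewrite hP; apply: ler_sum => j /eqP; exact: Ple.
(* At the hit, the coordinate of [d] is -1 while those of [s] are nonnegative: the combination gives
   -1, the positive part of [d] gives 0. *)
have ltT : orbit T d = \sum_i m i *: orbit T (x i) ->
    \sum_i m i * orbit_height T (x i) < orbit_height T d.
  move=> e; have /andP[/eqP hd /eqP sk] := hT.
  rewrite hP /orbit_height (bigD1 k) ?sk //= [ltRHS](bigD1 k) ?sk //=.
  apply: ltr_leD; last by apply: ler_sum => j /andP[/eqP sj _]; exact: Ple.
  rewrite (Plin _ _ e) => [|b bs].
    by rewrite hd coN co_Pi eqxx max_r ?ltrN10 // oppr_le0.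
  by apply: (hit_coG dG (sG _ bs) _ hT); apply: contraNneq ds => ->.
have [[t' t'T nt]|al] := pselect (exists2 t, (t <= T)%N &
    orbit_height t d != \sum_i m i * orbit_height t (x i)); last first.
  exists T; split=> // [t tT|].
    by apply/eqP; apply: contrapT => /negP nt; apply: al; exists t;
      rewrite // ltnW.
  apply/ltT/eq_orb => t tT.
  by apply/eqP; apply: contrapT => /negP nt; apply: al; exists t;
    rewrite // ltnW.
pose Q t := orbit_height t d != \sum_i m i * orbit_height t (x i).
have exQ : exists t, Q t by exists t'.
case: (ex_minnP exQ) => t0 Q0 min0.
have small t : (t < t0)%N ->
    orbit_height t d = \sum_i m i * orbit_height t (x i).
  by move=> lt; apply/eqP; apply: contraTT lt => /min0; rewrite leqNgt.
exists t0; split=> //; first exact: leq_trans (min0 _ nt) t'T.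
rewrite lt_neqAle eq_sym; apply/andP; split; first exact: Q0.
by apply: le; exact: eq_orb.
Qed.

(** * Flips of compatible sets *)

Definition twisted (a : bool) (th w : V) : R :=
  \sum_(k | sgn k == a) dnorm k * co k th * co k w
  - \sum_(k | sgn k != a) dnorm k * co k th * co k w.

Lemma pairing_opp k v : pairing k v = 2 * co k v + opp_sum (sgn k) k v.
Proof.
rewrite pairing_diag /opp_sum; congr (_ + _).
rewrite (bigID (fun j => sgn j == sgn k)) /= big1 ?add0r; last first.
  by move=> j /andP[jk /eqP sj]; rewrite cartan_same 1?eq_sym ?mul0r // sj.
by apply: eq_bigl => j; have [->|//] := eqVneq j k; rewrite eqxx.
Qed.

(** As [w] vanishes on colour [a] outside [K], [th] may be treated as reflected in all of colour
    [a]. This changes colour [a] of [th], while [tau] changes the other colour of [w]; the two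
    neighbour sums cancel because [dnorm i * A i j] is symmetric. *)
Lemma twisted_step (a : bool) (K : pred 'I_n) th w :
  (forall k, K k -> sgn k = a) -> (forall k, sgn k = a -> 0 <= co k w) ->
  (forall k, sgn k = a -> ~~ K k -> co k w = 0) ->
  twisted (~~ a) (reflK K th) (tau (~~ a) w) = twisted a th w.
Proof.
move=> Ka w0 wK.
have neb b : (b == ~~ a) = (b != a) by case: b; case: (a).
have nebb b : (b != ~~ a) = (b == a) by case: b; case: (a).
rewrite /twisted; under eq_bigl do rewrite neb.
under [X in _ - X]eq_bigl do rewrite nebb.
have wpos j : sgn j != ~~ a -> 0 <= co j w by rewrite nebb => /eqP/w0.
under eq_bigr => k sk.
  have nKk : K k = false by apply/negP => /Ka ska; rewrite ska eqxx in sk.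
  rewrite co_reflK nKk mul0r subr0 (co_tau_opp _ wpos) neb sk mulrBr mulrN.
  over.
under [X in _ - X]eq_bigr => k sk.
  rewrite (co_tau_opp _ wpos) neb sk /= co_reflK.
  have -> : dnorm k * (co k th - (K k)%:R * pairing k th) * co k w =
      dnorm k * co k th * co k w - dnorm k * pairing k th * co k w.
    have [Kk|/(wK _ (eqP sk)) ->] := boolP (K k); last by rewrite !mulr0 subr0.
    by rewrite mul1r; ring.
  rewrite pairing_opp (eqP sk).
  over.
rewrite !sumrB.
have ex : \sum_(k | sgn k != a) dnorm k * co k th * opp_sum (~~ a) k w =
    \sum_(k | sgn k == a) dnorm k * opp_sum a k th * co k w.
  rewrite /opp_sum; under eq_bigr do rewrite mulr_sumr.
  rewrite (exchange_big_dep (fun k => sgn k == a)) /=; last first.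
    by move=> i j _; rewrite nebb.
  apply: eq_bigr => k sk; rewrite mulr_sumr mulr_suml.
  apply: eq_big => [i|i _]; first by rewrite nebb sk andbT.
  by rewrite !mulrA cartan_sym; ring.
rewrite ex sumrN.
have -> : \sum_(k | sgn k == a) dnorm k * (2 * co k th + opp_sum a k th) * co k w
  = 2 * \sum_(k | sgn k == a) dnorm k * co k th * co k w
    + \sum_(k | sgn k == a) dnorm k * opp_sum a k th * co k w.
  rewrite mulr_sumr -big_split; apply: eq_bigr => k _ /=; ring.
ring.
Qed.

Lemma twisted_simple (a : bool) k w : twisted a Pi`_k w =
  if sgn k == a then dnorm k * co k w else - (dnorm k * co k w).
Proof.
have z (Q : pred 'I_n) : \sum_(j | Q j) dnorm j * co j Pi`_k * co j w =
    if Q k then dnorm k * co k w else 0.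
  rewrite big_mkcond (bigD1 k) //= co_Pi eqxx mulr1 big1 ?addr0 // => j jk.
  by rewrite co_Pi (negPf jk) mulr0 mul0r; case: ifP.
by rewrite /twisted !z; case: eqP; rewrite ?subr0 ?sub0r.
Qed.

Lemma twisted_neg_simple (a : bool) k th : twisted a th (- Pi`_k) =
  if sgn k == a then - (dnorm k * co k th) else dnorm k * co k th.
Proof.
have z (Q : pred 'I_n) : \sum_(j | Q j) dnorm j * co j th * co j (- Pi`_k) =
    if Q k then - (dnorm k * co k th) else 0.
  rewrite big_mkcond (bigD1 k) //= coN co_Pi eqxx mulrN1 big1 ?addr0 // => j jk.
  by rewrite coN co_Pi (negPf jk) oppr0 mulr0; case: ifP.
by rewrite /twisted !z; case: eqP; rewrite ?subr0 ?sub0r ?opprK.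
Qed.

(* After b reaches a negative simple root -alpha_k, the positive root th starts
   at alpha_k and is reflected in the active simple roots that are not currently
   cancelled by an element of s. The pairing [twisted] of th with the orbits is
   preserved, so th stays orthogonal to s, and it cannot stay positive up to the
   next hit of b: when it becomes simple, its opposite completes s. *)
Lemma pcompat_flip s b : b \notin s -> pcompat (b :: s) ->
  exists2 d, d \notin b :: s & pcompat (d :: s).
Proof.
move=> bs bsP; have [sG cP] := pcompatP _ bsP.
have bin : b \in b :: s by rewrite inE eqxx.
have sin a : a \in s -> a \in b :: s by rewrite inE => ->; rewrite orbT.
have ab a : a \in s -> a != b by apply: contraTneq => ->.
apply: contrapT => nd.
pose inv t th := [/\ posroot th, {in s, forall a, twisted (odd t) th (orbit t a) = 0}
  & 0 < twisted (odd t) th (orbit t b)].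
have nohit t th : inv t th -> forall k, ~~ hits t k b.
  move=> [/posrootP[_ th0] _ thb] k;
    apply: contraTN thb => /andP[/eqP -> /eqP sk].
  rewrite twisted_neg_simple sk eqxx -leNgt oppr_le0.
  by rewrite mulr_ge0 // ltW // dnorm_simple_gt0.
have step t th : inv t th -> exists th', inv t.+1 th'.
  move=> ith; have [thP ths thb] := ith.
  pose K : pred 'I_n := fun k => (sgn k == odd t) && ~~ has (hits t k) s.
  (* If [th] is some [alpha_k] with [k] in [K], take the [d] that is at [-alpha_k] at time [t]:
     orthogonality of [th] to [s] is compatibility of [d] with [s]. *)
  have [/existsP[k /andP[/andP[/eqP sk /hasPn hk] /eqP the]]|/existsPn nK] :=
      boolP [exists k : 'I_n, K k && (th == Pi`_k)].
    have [d dG dk] := orbit_onto t (G_neg_simple k).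
    case: nd; exists d.
      rewrite inE negb_or; apply/andP; split.
        apply/eqP => db; have := nohit _ _ ith k.
        by rewrite /hits -db dk eqxx sk eqxx.
      by apply/negP => /hk; rewrite /hits dk eqxx sk eqxx.
    have ds a : a \in s -> c d a = 0%N.
      move=> aS; have aG := sG _ (sin _ aS).
      apply/eqP; rewrite -(compat_orbit t) // dk compat_neg_simple0 ?orbit_G //.
      have /eqP := ths _ aS; rewrite the twisted_simple sk eqxx mulf_eq0.
      by rewrite (gt_eqF (dnorm_simple_gt0 k)) /= => /eqP ->.
    apply/pcompatP; split=> [v|v w]; rewrite !inE.
      by case/orP=> [/eqP ->|/sin/sG].
    case/orP=> [/eqP ->|vs]; case/orP=> [/eqP ->|ws]; first exact: compat_refl.
    - exact: ds.
    - by apply: compat_sym => //; [exact/sG/sin|exact: ds].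
    - by apply: cP; exact: sin.
  exists (reflK K th); split.
  - apply: reflK_posroot => // [i j /andP[/eqP -> _] /andP[/eqP -> _] //|k Kk].
    by have := nK k; rewrite Kk.
  (* An element of [s] with a hit at [t] is fixed by the next map and its [k] lies outside [K], so
     the pairing only changes sign. *)
  - move=> a aS; have [/existsP[k hk]|/existsPn nh] :=
    boolP [exists k, hits t k a].
      have /andP[/eqP ak /eqP sk] := hk.
      have nKk : K k = false.
        by apply/negP => /andP[_ /hasPn /(_ _ aS)]; rewrite hk.
      have nodd : (odd t == ~~ odd t) = false by case: (odd t).
      rewrite /= ak tau_neg_simple sk nodd twisted_neg_simple sk nodd.
      rewrite co_reflK nKk mul0r subr0.
      have := ths _ aS; rewrite ak twisted_neg_simple sk eqxx.
      by move/eqP; rewrite oppr_eq0 => /eqP.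
    rewrite -(ths _ aS) /=; apply: twisted_step => [k /andP[/eqP]|k sk|k sk] //.
      apply: co_G_ge0; first exact/orbit_G/sG/sin.
      by have := nh k; rewrite /hits sk eqxx andbT.
    rewrite /K sk eqxx negbK /= => /hasP[a' a's ha'].
    apply: (pcompat_co0 bsP _ _ _ ha'); rewrite ?sin //.
    by apply: contraTneq ha' => ->; exact: nh.
  - have := thb; rewrite -(twisted_step (K := K)) //=.
    + by move=> k /andP[/eqP].
    + move=> k sk; apply: co_G_ge0; first exact/orbit_G/sG.
      by have := nohit _ _ ith k; rewrite /hits sk eqxx andbT.
    + move=> k sk; rewrite /K sk eqxx negbK /= => /hasP[a' a's ha'].
      by apply: (pcompat_co0 bsP _ bin _ ha'); rewrite ?sin ?ab.
have [t0 [k [_ hk]]] := orbit_hits 0 (sG _ bin).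
(* Just after the hit, [b] is still at [-alpha_k], whose colour now carries the minus sign, so the
   pairing with [alpha_k] is positive. *)
have init : inv t0.+1 Pi`_k.
  have /andP[/eqP bk /eqP sk] := hk.
  have sk' : (sgn k == odd t0.+1) = false by rewrite sk /=; case: (odd t0).
  have sk2 : (sgn k == ~~ odd t0) = false by rewrite -sk'.
  split; first exact: posroot_simple.
    move=> a aS; rewrite twisted_simple sk' /= co_tau sk2.
    by rewrite (pcompat_co0 bsP bin _ _ hk) ?sin // 1?eq_sym ?ab // mulr0 oppr0.
  rewrite twisted_simple sk' /= co_tau sk2 bk coN co_Pi eqxx mulrN1 opprK.
  exact: dnorm_simple_gt0.
have all_inv r : exists th, inv (t0.+1 + r)%N th.
  elim: r => [|r [th /step]]; first by exists Pi`_k; rewrite addn0.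
  by rewrite addnS.
have [t1 [j [le hj]]] := orbit_hits t0.+1 (sG _ bin).
have [th ith] := all_inv (t1 - t0.+1)%N.
by rewrite subnKC // in ith; have := nohit _ _ ith j; rewrite hj.
Qed.

(** * Containment between cones of compatible sets *)

Lemma pcompat_max_sum s t k (I : finType) (x : I -> V) (l : I -> R) :
  pcompat s -> (forall u, x u \in s) -> (forall u, 0 <= l u) -> sgn k = odd t ->
  \sum_u l u * Num.max (co k (orbit t (x u))) 0 =
  Num.max (co k (\sum_u l u *: orbit t (x u))) 0.
Proof.
move=> sP xs l0 sk; rewrite co_bigsum.
under [in RHS]eq_bigr do rewrite coZ.
have [[_ h]|h] := pcompat_active sP sk.
  rewrite big1 => [|u _]; last by rewrite max_r ?mulr0 ?h.
  by rewrite max_r // sumr_le0 // => u _; rewrite mulr_ge0_le0 ?h.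
rewrite (eq_bigr (fun u => l u * co k (orbit t (x u)))) => [|u _].
  by rewrite max_l // sumr_ge0 // => u _; rewrite mulr_ge0 ?h.
by rewrite max_l ?h.
Qed.

(** Both combinations move together along orbits, positive parts being additive on each cone. At a
    hit of [a] the sum has a negative coordinate, so some [y u] has one too; it is then at
    [-alpha_k], hence equals [a]. *)
Lemma pcompat_cone_sub s r (I : finType) (y : I -> V) (l : I -> R) :
  uniq s -> pcompat s -> pcompat r -> (forall u, y u \in r) ->
  (forall u, 0 <= l u) -> \sum_(a <- s) a = \sum_u l u *: y u ->
  {subset s <= r}.
Proof.
move=> us sP rP yr l0 sy a aS; have [sG _] := pcompatP _ sP.
have [rG _] := pcompatP _ rP.
pose x (j : 'I_(size s)) := s`_j.
have xs (j : 'I_(size s)) : x j \in s by rewrite mem_nth.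
have orb t : \sum_(j : 'I_(size s)) 1 *: orbit t (x j) =
    \sum_u l u *: orbit t (y u).
  elim: t => [|t IH].
    by rewrite -sy (big_nth 0) big_mkord; apply: eq_bigr => j _;
      rewrite scale1r.
  have := @tau_combination (~~ odd t) _ _ (fun=> 1) (fun j :
      'I_(size s) => orbit t (x j)) l
    (fun u => orbit t (y u)) IH; apply=> k sk.
  have {}sk : sgn k = odd t by move: sk; case: (sgn k); case: (odd t).
  rewrite (@pcompat_max_sum s t k _ x (fun=> 1)) // IH.
  by rewrite (@pcompat_max_sum r t k _ y l).
have [t [k [_ hk]]] := orbit_hits 0 (sG _ aS); have /andP[/eqP ak _] := hk.
have [u] : exists u, l u * co k (orbit t (y u)) < 0.
  have : \sum_u l u * co k (orbit t (y u)) < 0.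
    have -> : \sum_u l u * co k (orbit t (y u)) =
        co k (\sum_u l u *: orbit t (y u)).
      by rewrite co_bigsum; apply: eq_bigr => u _; rewrite coZ.
    have ilt : (index a s < size s)%N by rewrite index_mem.
    rewrite -orb co_bigsum (bigD1 (Ordinal ilt)) //= big1 ?addr0.
      by rewrite scale1r /x /= nth_index // ak coN co_Pi eqxx ltrN10.
    move=> j ji; rewrite scale1r (pcompat_co0 sP aS _ _ hk) //.
    by apply: contra ji => /eqP aj; apply/eqP/val_inj; rewrite /= aj index_uniq.
  move=> neg; apply: contrapT => nex; move: neg; apply/negP; rewrite -leNgt.
  by apply: sumr_ge0 => u _; rewrite leNgt; apply/negP => h; apply: nex;
    exists u.
move=> neg; suff -> : a = y u by exact: yr.
apply: (@orbit_inj t); rewrite ak; apply/esym/eqP; apply: contraLR neg => nk.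
by rewrite -leNgt mulr_ge0 // co_G_ge0 // orbit_G // rG.
Qed.

Lemma pcompat_sub s r : {subset s <= r} -> pcompat r -> pcompat s.
Proof.
move=> sr /pcompatP[rG h]; apply/pcompatP;
  split=> [v /sr/rG //|v w /sr vr /sr wr].
exact: h.
Qed.

Lemma dim_fullv : \dim {: V} = n.
Proof. by rewrite -(size_basis (simple_basis simpleP)). Qed.

Lemma basis_pcompat (s : n.-tuple V) : uniq s -> pcompat s -> basis_of fullv s.
Proof.
move=> us sP; rewrite basisEfree free_pcompat //= subvf /=.
by rewrite dim_fullv size_tuple.
Qed.

Lemma pcompat_basis_max (s : n.-tuple V) d : uniq s -> pcompat (d :: s) ->
  d \in s.
Proof.
move=> us dsP; apply: contraT => ds.
have /free_pcompat : uniq (d :: s) by rewrite /= ds.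
move=> /(_ dsP) /eqP fr; have := dimvS (subvf <<d :: s>>%VS).
by rewrite fr dim_fullv /= size_tuple ltnn.
Qed.

(** * Clusters as the cones of a strictly convex function *)

Hypothesis n_gt0 : (0 < n)%N.

(** Tuples are ordered, so a cluster occurs once per ordering; only the set of cones matters. *)
Let Z : finType :=
  {t : n.-tuple (seq_sub G) | uniq t && pcompat [seq val u | u <- t]}.
Let cone_gen (z : Z) : n.-tuple V := map_tuple val (val z).

Let cone_gen_uniq z : uniq (cone_gen z).
Proof. by rewrite map_inj_uniq; [case/andP: (valP z) | exact: val_inj]. Qed.

Let cone_gen_pcompat z : pcompat (cone_gen z).
Proof. by case/andP: (valP z). Qed.

Let cone_gen_onto (s : n.-tuple V) : uniq s -> pcompat s ->
  exists z, cone_gen z = s.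
Proof.
move=> us sP; have [sG _] := pcompatP _ sP.
pose u0 : seq_sub G := SeqSub (G_neg_simple (Ordinal n_gt0)).
pose t : n.-tuple (seq_sub G) := map_tuple (insubd u0) s.
have ts : [seq val u | u <- t] = s.
  rewrite -map_comp -[RHS]map_id; apply/eq_in_map => v /sG vG.
  by rewrite /= insubdK.
have tP : uniq t && pcompat [seq val u | u <- t].
  by rewrite ts sP andbT -(map_inj_uniq val_inj) ts.
by exists (exist _ t tP); apply: val_inj.
Qed.

Let negPi : n.-tuple V := map_tuple -%R Pi.

Let negPi_pcompat : pcompat negPi.
Proof.
have mem v : v \in negPi -> exists k, v = - Pi`_k.
  case/mapP => w /(nthP 0)[i]; rewrite size_tuple => lt <- ->.
  by exists (Ordinal lt).
apply/pcompatP; split=> [_ /mem[k ->]|_ _ /mem[k ->] /mem[j ->]].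
  exact: G_neg_simple.
apply/eqP; rewrite compat_neg_simple0 ?G_neg_simple //.
by rewrite coN co_Pi oppr_le0 ler0n.
Qed.

Let negPi_uniq : uniq negPi.
Proof. by rewrite map_inj_uniq ?(free_uniq freePi) //; exact: oppr_inj. Qed.

Let cone_gen_flip z i : exists2 z', (cone_gen z)`_i \notin cone_gen z' &
  forall j, j != i -> (cone_gen z)`_j \in cone_gen z'.
Proof.
set s := cone_gen z; have us := cone_gen_uniq z; have sP := cone_gen_pcompat z.
have sz : size s = n by rewrite size_tuple.
have bs : s`_i \in s by rewrite mem_nth // sz.
have memr v : (v \in rem s`_i s) = (v != s`_i) && (v \in s).
  by rewrite mem_rem_uniq // inE.
have bP : pcompat (s`_i :: rem s`_i s).
  apply: pcompat_sub sP => v; rewrite inE memr => /orP[/eqP -> //|/andP[]//].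
have [|d] := pcompat_flip _ bP; first by rewrite memr eqxx.
rewrite inE negb_or => /andP[di dr] dP.
have szd : size (d :: rem s`_i s) == n by rewrite /= size_rem // sz prednK.
have [|z' z'E] := cone_gen_onto (s := Tuple szd) _ dP.
  by rewrite /= dr rem_uniq.
exists z'; rewrite z'E.
  by rewrite inE negb_or eq_sym di memr eqxx.
move=> j ji; rewrite inE memr mem_nth ?sz // nth_uniq ?sz //.
by rewrite [_ == i :> nat](negPf ji) orbT.
Qed.

Let cone_gen_basis z : basis_of fullv (cone_gen z).
Proof. exact: basis_pcompat. Qed.

Let hit_bound : exists T, forall d, d \in G ->
  exists t k, (t <= T)%N /\ hits t k d.
Proof.
have /choice[t tP] : forall u : seq_sub G, exists t, exists k, hits t k (val u).
  by move=> u; have [t [k [_ h]]] := orbit_hits 0 (valP u); exists t, k.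
exists (\max_u t u)%N => d dG; have [k hk] := tP (SeqSub dG).
by exists (t (SeqSub dG)), k; split=> //; exact: leq_bigmax.
Qed.

Let cone_gen_convex : exists F : V -> R, forall z z' d, d \in cone_gen z' ->
  d \notin cone_gen z ->
  \sum_i coord (cone_gen z) i d * F (cone_gen z)`_i < F d.
Proof.
have [T hT] := hit_bound.
pose defect z d t := orbit_height t d
  - \sum_i coord (cone_gen z) i d * orbit_height t (cone_gen z)`_i.
(* The value 1 fills the pairs with the root among the cone generators, where convexity asks
   nothing, so that one [q] serves all pairs. *)
pose D (zd : Z * seq_sub G) t : R :=
  if val zd.2 \in cone_gen zd.1 then 1 else defect zd.1 (val zd.2) t.
have [|q qP] := @lex_weights R T _ D.
  move=> [z u]; rewrite /D /=; have [_|uz] := boolP (val u \in cone_gen z).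
    by exists 0%N; split.
  have [t [k [tT hk]]] := hT _ (valP u).
  have uE : val u = \sum_i coord (cone_gen z) i (val u) *: (cone_gen z)`_i.
    by apply: coord_basis; [exact: cone_gen_basis | exact: memvf].
  have [|t0 [t0t tl tt]] := orbit_height_lex (cone_gen_pcompat z) _ uz uE (valP u) hk.
    by move=> i; rewrite mem_nth // size_tuple.
  exists t0; split; first exact: leq_trans t0t tT.
    by move=> s /tl sl; rewrite /defect sl subrr.
  by rewrite subr_gt0.
exists (fun d => \sum_(t < T.+1) q ^+ t * orbit_height t d) => z z' d dz' dz.
have [zG _] := pcompatP _ (cone_gen_pcompat z').
have Dd t : D (z, SeqSub (zG _ dz')) t =
    defect z d t by rewrite /D /= (negPf dz).
have := qP (z, SeqSub (zG _ dz')); under eq_bigr do rewrite Dd.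
move=> pos; rewrite -subr_gt0; apply: lt_le_trans pos _; rewrite le_eqVlt.
apply/orP; left; apply/eqP.
rewrite (eq_bigr (fun t : 'I_T.+1 => q ^+ t * orbit_height t d -
  \sum_i coord (cone_gen z) i d * (q ^+ t * orbit_height t (cone_gen z)`_i))).
  rewrite sumrB exchange_big; congr (_ - _); apply: eq_bigr => i _.
  by rewrite mulr_sumr.
move=> t _; rewrite /defect mulrBr; congr (_ - _); rewrite mulr_sumr.
by apply: eq_bigr => i _; rewrite mulrCA.
Qed.

(** The sum of a cluster lies in some cone of [Z], whose generators then contain the cluster;
    maximality gives equality. Conversely, independence bounds compatible sets by [n] elements, so
    nothing can be added. *)
Lemma cluster_cone_gen K : cluster Phi Pi c K <->
  exists z, K = [set` cone_gen z].
Proof.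
split=> [[[KG Kc] Kmax]|[z ->]].
  pose s := [seq a <- undup G | `[< K a >]].
  have sK a : (a \in s) = `[< K a >].
    rewrite mem_filter mem_undup andb_idr // => /asboolP /KG.
    exact.
  have us : uniq s by rewrite filter_uniq // undup_uniq.
  have sP : pcompat s.
    apply/pcompatP; split=> [v|v w]; rewrite !sK => /asboolP Kv;
      first exact: KG.
    by move=> /asboolP Kw; exact: Kc.
  have [F convexF] := cone_gen_convex.
  have [z0 _] := cone_gen_onto negPi_uniq negPi_pcompat.
  have [z zs] := cone_cover z0 cone_gen_basis convexF cone_gen_flip (\sum_(a <- s) a).
  have sz : {subset s <= cone_gen z}.
    apply: (@pcompat_cone_sub _ _ _ (fun i => (cone_gen z)`_i) _ us sP _ _ zs).
    - exact: cone_gen_pcompat.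
    - by move=> i; rewrite mem_nth // size_tuple.
    - by apply: coord_basis; [exact: cone_gen_basis | exact: memvf].
  exists z; apply/esym/Kmax => [|a Ka]; last by apply: sz; rewrite sK;
    exact/asboolP.
  by have /pcompatP[zG zc] := cone_gen_pcompat z; split=> [v /zG //|v w vz wz];
    exact: zc.
split; last first.
  move=> D [DG Dc] CD; apply/seteqP; split=> // d Dd.
  apply: pcompat_basis_max => //; apply/pcompatP; split=> [v|v w]; rewrite !inE.
    by move=> /orP[/eqP ->|/CD]; [exact: DG | exact: DG].
  by case/orP=> [/eqP ->|/CD ?]; case/orP=> [/eqP ->|/CD ?]; exact: Dc.
have /pcompatP[zG zc] := cone_gen_pcompat z.
by split=> [v /zG //|v w vz wz]; exact: zc.
Qed.

Lemma cluster_fan_polytope : exists P : set 'Hom(V, R^o),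
  simple_polytope n P /\ cluster_fan Phi Pi c = normal_fan P.
Proof.
have [F convexF] := cone_gen_convex.
have [z0 _] := cone_gen_onto negPi_uniq negPi_pcompat.
have [P [Psimple Pfan]] := polytope_exists z0 n_gt0 cone_gen_basis convexF cone_gen_flip.
exists P; split=> //; rewrite -Pfan /cluster_fan; congr fan_of.
apply/seteqP; split=> M /=.
  by move=> [K /cluster_cone_gen[z ->] <-]; exists z.
by move=> [z _ <-]; exists [set` cone_gen z] => //; apply/cluster_cone_gen;
  exists z.
Qed.

End RootCombinatorics.

Theorem theorem1p4 (R : realType) (V : vectType R)
    (form : {dot V for idfun}) (Phi : seq V) (n : nat) (Pi : n.-tuple V)
    (sgn : 'I_n -> bool) (c : V -> V -> nat)
    (Phi_root_system : is_root_system form Phi)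
    (Phi_irreducible : irreducible_roots form Phi)
    (Pi_simple : is_simple_system Phi Pi)
    (sgn_bipartition : is_bipartition form Pi sgn)
    (c_compatibility : is_compatibility_degree form Phi Pi sgn c) :
  exists P : set 'Hom(V, R^o),
    simple_polytope n P /\ cluster_fan Phi Pi c = normal_fan P.
Proof.
(* With an empty basis every root would be zero, while irreducibility provides a root. *)
have n_gt0 : (0 < n)%N.
  rewrite lt0n; apply/eqP => n0; subst n; case: Phi_irreducible => Phi0 _.
  have : Phi`_0 \in Phi by rewrite mem_nth // lt0n size_eq0.
  move=> /(root_nz Phi_root_system) /eqP; apply.
  by rewrite (coord_basis (simple_basis Pi_simple) (memvf Phi`_0)) big_ord0.
exact: (cluster_fan_polytope Phi_root_system Pi_simple sgn_bipartition
  c_compatibility n_gt0).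
Qed.
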